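(* Let $(M,g)$ be a quaternion null submanifold of a normal indefinite complex contact manifold $\overline{M}$. Then $M$ is totally geodesic in $\overline{M}$, i.e. $h^{l}(X,Y)=0$ and $h^{s}(X,Y)=0$ for all $X,Y\in\Gamma(TM)$.
   Context: **Ambient manifold.** $\overline{M}$ is a complex contact manifold of complex dimension $2n+1$ (real dimension $4n+2$): it has an open cover with holomorphic 1-forms $\theta_i$ satisfying $\theta_i\wedge(d\theta_i)^n\neq 0$ and $\theta_i=f_{ij}\theta_j$ on overlaps, $f_{ij}$ holomorphic and non-vanishing. $J$ is its complex structure, $\overline{g}$ a Hermitian semi-Riemannian metric of index $4q$, $0<q<n$, with Levi-Civita connection $\overline\nabla$. On each set of the cover there are 1-forms $u$, $v=u\circ J$ (with $\theta=u-iv$ up to a nonvanishing complex-valued function), orthogonal dual vector fields $U$ and $V=-JU$, and (1,1)-tensors $G$, $H=GJ$ with $G^2=H^2=-I+u\otimes U+v\otimes V$, $\overline g(GX,Y)=-\overline g(X,GY)$, $\overline g(U,X)=u(X)$, $GJ=-JG$, $GU=0$, $u(U)=1$; on overlaps $u'=au-bv$, $v'=bu+av$, $G'=aG-bH$, $H'=bG+aH$ with $a^2+b^2=1$. Moreover $du(X,Y)=\overline g(X,GY)+(\sigma\wedge v)(X,Y)$ and $dv(X,Y)=\overline g(X,HY)-(\sigma\wedge u)(X,Y)$, where $\sigma(X)=\overline g(\overline\nabla_XU,V)$. $\mathcal V=\mathrm{Span}\{U,V\}$ is the (global) characteristic subbundle, $\mathcal{H}=\mathcal V^\perp$ the horizontal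 one. $\overline M$ is *normal* if $S(X,Y)=T(X,Y)=0$ for $X,Y\in\Gamma(\mathcal H)$ and $S(U,X)=T(V,X)=0$ for all $X$, where, with $[\cdot,\cdot]$ of a tensor denoting its Nijenhuis tensor, $S(X,Y)=[G,G](X,Y)+2\overline g(X,GY)U-2\overline g(X,HY)V+2\{v(Y)HX-v(X)HY\}+\sigma(GY)HX-\sigma(GX)HY+\sigma(X)GHY-\sigma(Y)GHX$, $T(X,Y)=[H,H](X,Y)-2\overline g(X,GY)U+2\overline g(X,HY)V+2\{u(Y)GX-u(X)GY\}+\sigma(HX)GY-\sigma(HY)GX+\sigma(X)GHY-\sigma(Y)GHX$. (Conventions for $d$ and $\wedge$ are those for which, on a normal manifold, $\overline\nabla_XU=-GX+\sigma(X)V$ and $\overline\nabla_XV=-HX-\sigma(X)U$.) **Null submanifolds.** A submanifold $M$ of $\overline M$ with induced (degenerate) metric $g$ is *null* if $\mathrm{Rad}\,TM=TM\cap TM^\perp$ is a smooth distribution of constant rank $r>0$. Fix a screen distribution $S(TM)$ (nondegenerate, $TM=\mathrm{Rad}\,TM\perp S(TM)$), a screen transversal bundle $S(TM^\perp)$ (nondegenerate, $TM^\perp=\mathrm{Rad}\,TM\perp S(TM^\perp)$), and the null transversal bundle $l\mathrm{tr}(TM)$, locally spanned by null sections $N_i$ of the orthogonal complement of $S(TM^\perp)$ in $S(TM)^\perp$ with $\overline g(\xi_i,N_j)=\delta_{ij}$, $\overline g(N_i,N_j)=0$ for a local basis $\{\xi_i\}$ of $\mathrm{Rad}\,TM$.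 Then $T\overline M|_M=TM\oplus \mathrm{tr}(TM)$ with $\mathrm{tr}(TM)=l\mathrm{tr}(TM)\perp S(TM^\perp)$. For $X,Y\in\Gamma(TM)$ write $\overline\nabla_XY=\nabla_XY+h^l(X,Y)+h^s(X,Y)$ with components in $TM$, $l\mathrm{tr}(TM)$, $S(TM^\perp)$ respectively. **Quaternion null submanifold.** $M$ is tangent to $\mathcal V$ (meaning $\mathcal V\subset S(TM)$), and both $\mathrm{Rad}\,TM$ and $S(TM)$ are invariant under each of $J,G,H$. *)

(* Defs.v *)
From mathcomp Require Import all_boot all_order all_algebra all_fingroup.
From mathcomp Require Import all_classical all_reals all_analysis.
From mathcomp Require Import complex.

Set Implicit Arguments.
Unset Strict Implicit.
Unset Printing Implicit Defensive.

Import Order.TTheory GRing.Theory Num.Theory.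
Import numFieldNormedType.Exports.

Local Open Scope classical_set_scope.
Local Open Scope ring_scope.

(* C^k maps on an open set: the j-th iterated directional derivatives are
   Frechet differentiable for j < k and continuous for j = k. *)
Fixpoint Ck (R : realType) (V W : normedModType R) (k : nat)
    (A : set V) (f : V -> W) : Prop :=
  if k is k'.+1 then
    (forall x, A x -> differentiable f x) /\
    (forall v, Ck k' A (fun x => 'D_v f x))
  else forall x, A x -> {for x, continuous f}.

Definition smooth_on (R : realType) (V W : normedModType R)
    (A : set V) (f : V -> W) : Prop := forall k, Ck k A f.

(* A smooth m-manifold.  The atlas is indexed by the points: [chart p] is a
   chart around p (an arbitrary atlas gives one by choosing charts).  The
   tangent space at p is 'rV[R]_m, a tangent vector being identified with its
   components in [chart p]; (1,1)-tensors, 1-forms and bilinear forms at p are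
   matrices in 'M[R]_m, 'cV[R]_m and 'M[R]_m.  Linear maps act on the right of
   row vectors, so the composite A o B is the matrix product B *m A. *)
Record manifold (R : realType) (m : nat) := Manifold {
  carrier :> topologicalType;
  dom : carrier -> set carrier;
  chart : carrier -> carrier -> 'rV[R]_m;
  unchart : carrier -> 'rV[R]_m -> carrier;
  manifold_hausdorff : hausdorff_space carrier;
  manifold_second_countable : @second_countable carrier;
  dom_open : forall p, open (dom p);
  dom_self : forall p, dom p p;
  chart_open : forall p, open (chart p @` dom p);
  chartK : forall p q, dom p q -> unchart p (chart p q) = q;
  chart_continuous : forall p q, dom p q -> {for q, continuous (chart p)};
  unchart_continuous : forall p x, (chart p @` dom p) x ->
    {for x, continuous (unchart p)};
  transition_smooth : forall p q,
    smooth_on (chart p @` (dom p `&` dom q)) (chart q \o unchart p) }.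

Arguments dom {R m} _ _.
Arguments chart {R m} _ _ _.
Arguments unchart {R m} _ _ _.

Section Calculus.
Context {R : realType} {m : nat} (M : manifold R m).

Definition smooth_fun (O : set M) (f : M -> R) : Prop :=
  forall p, smooth_on (chart M p @` (dom M p `&` O)) (f \o unchart M p).

(* v f, the derivative of f at p along the tangent vector v. *)
Definition dfun (f : M -> R) (p : M) (v : 'rV[R]_m) : R :=
  'D_v (f \o unchart M p) (chart M p p).

(* Vector fields are total functions that are only considered on the open set
   on which they are required to be smooth; the same holds for the other
   tensor fields. *)
Definition vfield := M -> 'rV[R]_m.

Definition lie_deriv (X : vfield) (f : M -> R) : M -> R :=
  fun p => dfun f p (X p).

Definition smooth_vf (O : set M) (X : vfield) : Prop :=
  forall (O' : set M) (f : M -> R), open O' -> O' `<=` O ->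
    smooth_fun O' f -> smooth_fun O' (lie_deriv X f).

Definition coord (p : M) (j : 'I_m) : M -> R := fun q => chart M p q 0 j.

(* Component j of [X, Y] at p is [X, Y] applied to the j-th coordinate of the
   chart around p. *)
Definition bracket (X Y : vfield) : vfield := fun p =>
  \row_j (lie_deriv X (lie_deriv Y (coord p j)) p
          - lie_deriv Y (lie_deriv X (coord p j)) p).

Definition tensor11 := M -> 'M[R]_m.

Definition act (A : tensor11) (X : vfield) : vfield := fun p => X p *m A p.

Definition smooth_tensor11 (O : set M) (A : tensor11) : Prop :=
  forall (O' : set M) X, open O' -> O' `<=` O ->
    smooth_vf O' X -> smooth_vf O' (act A X).

Definition nijenhuis (A : tensor11) (X Y : vfield) : vfield := fun p =>
  bracket (act A X) (act A Y) p + act A (act A (bracket X Y)) p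
  - act A (bracket (act A X) Y) p - act A (bracket X (act A Y)) p.

Definition form1 := M -> 'cV[R]_m.

Definition pair1 (a : form1) (X : vfield) : M -> R :=
  fun p => (X p *m a p) 0 0.

Definition smooth_form1 (O : set M) (a : form1) : Prop :=
  forall (O' : set M) X, open O' -> O' `<=` O ->
    smooth_vf O' X -> smooth_fun O' (pair1 a X).

(* The exterior derivative and the exterior product both carry the factor 1/2:
   with these conventions the identities for du and dv below agree with
   nabla_X U = - G X + sigma(X) V and nabla_X V = - H X - sigma(X) U. *)
Definition ext_deriv (a : form1) (X Y : vfield) : M -> R := fun p =>
  2^-1 * (lie_deriv X (pair1 a Y) p - lie_deriv Y (pair1 a X) p
          - pair1 a (bracket X Y) p).

Definition wedge (a b : vfield -> M -> R) (X Y : vfield) : M -> R := fun p =>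
  2^-1 * (a X p * b Y p - a Y p * b X p).

Definition gdot (g : M -> 'M[R]_m) (p : M) (v w : 'rV[R]_m) : R :=
  (v *m g p *m w^T) 0 0.

Record semi_riemannian (g : M -> 'M[R]_m) : Prop := SemiRiemannian {
  metric_sym : forall p, (g p)^T = g p;
  metric_nondeg : forall p, g p \in unitmx;
  metric_smooth : forall (O : set M) X Y, open O ->
    smooth_vf O X -> smooth_vf O Y ->
    smooth_fun O (fun p => gdot g p (X p) (Y p)) }.


Definition negative_on (B W : 'M[R]_m) : Prop :=
  forall v : 'rV[R]_m, (v <= W)%MS -> v != 0 -> (v *m B *m v^T) 0 0 < 0.

Definition has_index (B : 'M[R]_m) (s : nat) : Prop :=
  (exists2 W : 'M[R]_m, negative_on B W & \rank W = s) /\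
  (forall W : 'M[R]_m, negative_on B W -> (\rank W <= s)%N).

Record levi_civita (g : M -> 'M[R]_m) (D : vfield -> vfield -> vfield) : Prop :=
  LeviCivita {
  nabla_smooth : forall (O : set M) X Y, open O ->
    smooth_vf O X -> smooth_vf O Y -> smooth_vf O (D X Y);
  nabla_addl : forall (O : set M) X X' Y p, open O ->
    smooth_vf O X -> smooth_vf O X' -> smooth_vf O Y -> O p ->
    D (fun x => X x + X' x) Y p = D X Y p + D X' Y p;
  nabla_scalel : forall (O : set M) f X Y p, open O ->
    smooth_fun O f -> smooth_vf O X -> smooth_vf O Y -> O p ->
    D (fun x => f x *: X x) Y p = f p *: D X Y p;
  nabla_addr : forall (O : set M) X Y Y' p, open O ->
    smooth_vf O X -> smooth_vf O Y -> smooth_vf O Y' -> O p ->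
    D X (fun x => Y x + Y' x) p = D X Y p + D X Y' p;
  nabla_leibniz : forall (O : set M) f X Y p, open O ->
    smooth_fun O f -> smooth_vf O X -> smooth_vf O Y -> O p ->
    D X (fun x => f x *: Y x) p = lie_deriv X f p *: Y p + f p *: D X Y p;
  nabla_torsion_free : forall (O : set M) X Y p, open O ->
    smooth_vf O X -> smooth_vf O Y -> O p ->
    D X Y p - D Y X p = bracket X Y p;
  nabla_metric : forall (O : set M) X Y Z p, open O ->
    smooth_vf O X -> smooth_vf O Y -> smooth_vf O Z -> O p ->
    lie_deriv X (fun x => gdot g x (Y x) (Z x)) p
      = gdot g p (D X Y p) (Z p) + gdot g p (Y p) (D X Z p) }.

End Calculus.

(* The complex structure of C^N seen as R^N + R^N, z = x + iy. *)
Definition J0 {R : realType} (N : nat) : 'M[R]_(N + N) :=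
  block_mx 0 1%:M (- 1%:M) 0.

Record complex_manifold (R : realType) (N : nat) := ComplexManifold {
  real_manifold :> manifold R (N + N);
  transition_holomorphic : forall (p q : real_manifold) x,
    (chart real_manifold p @`
       (dom real_manifold p `&` dom real_manifold q)) x ->
    let tr := chart real_manifold q \o unchart real_manifold p in
    J0 N *m 'J tr x = 'J tr x *m J0 N }.

Section ComplexForms.
Context {R : realType} {N : nat} (M : complex_manifold R N).

Definition Jtensor : tensor11 M := fun=> J0 N.

Definition cdfun (f : M -> R[i]) (p : M) (v : 'rV[R]_(N + N)) : R[i] :=
  Complex (dfun (fun x => complex.Re (f x)) p v)
          (dfun (fun x => complex.Im (f x)) p v).

Definition holomorphic_fun (O : set M) (f : M -> R[i]) : Prop :=
  [/\ smooth_fun O (fun x => complex.Re (f x)),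
      smooth_fun O (fun x => complex.Im (f x)) &
      forall p v, O p -> cdfun f p (v *m J0 N) = Complex 0 1 * cdfun f p v].

Definition cform1 := M -> 'cV[R[i]]_(N + N).

Definition Reform (t : cform1) : form1 M := fun p => map_mx (@complex.Re R) (t p).
Definition Imform (t : cform1) : form1 M := fun p => map_mx (@complex.Im R) (t p).

Definition cpair (t : cform1) (X : vfield M) (p : M) : R[i] :=
  Complex (pair1 (Reform t) X p) (pair1 (Imform t) X p).

Definition cext_deriv (t : cform1) (X Y : vfield M) (p : M) : R[i] :=
  Complex (ext_deriv (Reform t) X Y p) (ext_deriv (Imform t) X Y p).

Definition zcoord (p : M) (j : 'I_N) : M -> R[i] := fun q =>
  Complex (chart M p q 0 (lshift N j)) (chart M p q 0 (rshift N j)).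

(* t = sum_j f_j dz_j with holomorphic f_j, in every chart. *)
Definition holomorphic_form1 (O : set M) (t : cform1) : Prop :=
  forall p, exists2 f : 'I_N -> M -> R[i],
    (forall j, holomorphic_fun (dom M p `&` O) (f j)) &
    (forall (X : vfield M) x, (dom M p `&` O) x ->
       cpair t X x = \sum_(j < N) f j x * cdfun (zcoord p j) x (X x)).

End ComplexForms.

Arguments Jtensor {R N} M _.

(* t /\ (dt)^n evaluated on 2n+1 vector fields, up to a positive constant. *)
Definition contact_volume (R : realType) (n : nat)
    (M : complex_manifold R n.*2.+1) (t : cform1 M)
    (X : 'I_n.*2.+1 -> vfield M) (p : M) : R[i] :=
  \sum_(s : 'S_n.*2.+1) (-1) ^+ s * cpair t (X (s ord0)) p *
    \prod_(k < n) cext_deriv t (X (s (inord k.*2.+1))) (X (s (inord k.*2.+2))) p.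

Record contact_structure (R : realType) (n : nat)
    (M : complex_manifold R n.*2.+1) := ContactStructure {
  cindex : Type;
  cset : cindex -> set M;
  ctheta : cindex -> cform1 M;
  cset_open : forall i, open (cset i);
  cset_cover : forall p, exists i, cset i p;
  ctheta_holomorphic : forall i, holomorphic_form1 (cset i) (ctheta i);
  ctheta_contact : forall i p, cset i p ->
    exists X : 'I_n.*2.+1 -> vfield M,
      (forall j, exists O : set M, [/\ open O, O p & smooth_vf O (X j)]) /\
      contact_volume (ctheta i) X p != 0;
  ctheta_overlap : forall i j, exists2 f : M -> R[i],
    holomorphic_fun (cset i `&` cset j) f &
    forall p, (cset i `&` cset j) p ->
      f p != 0 /\ ctheta i p = f p *: ctheta j p }.

Record frame (R : realType) (m : nat) (M : manifold R m) := Frame {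
  fu : form1 M; fv : form1 M;
  fU : vfield M; fV : vfield M;
  fG : tensor11 M; fH : tensor11 M }.

Section ContactMetric.
Context {R : realType} {n : nat} (M : complex_manifold R n.*2.+1).
Variables (g : M -> 'M[R]_(n.*2.+1 + n.*2.+1))
  (D : vfield M -> vfield M -> vfield M).

Definition hermitian_metric : Prop := forall p v w,
  gdot g p (v *m J0 n.*2.+1) (w *m J0 n.*2.+1) = gdot g p v w.

Definition sigma (F : frame M) (X : vfield M) : M -> R :=
  fun p => gdot g p (D X (fU F) p) (fV F p).

Record contact_frame (O : set M) (t : cform1 M) (F : frame M) : Prop :=
  ContactFrame {
  fu_smooth : smooth_form1 O (fu F);
  fU_smooth : smooth_vf O (fU F);
  fG_smooth : smooth_tensor11 O (fG F);
  fv_def : forall p, O p -> fv F p = Jtensor M p *m fu F p;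
  theta_uv : exists f : M -> R[i], forall (X : vfield M) p, O p ->
    f p != 0 /\
    cpair t X p = f p * Complex (pair1 (fu F) X p) (- pair1 (fv F) X p);
  fV_def : forall p, O p -> fV F p = - act (Jtensor M) (fU F) p;
  UV_orth : forall p, O p -> gdot g p (fU F p) (fV F p) = 0;
  U_dual : forall p v, O p -> gdot g p (fU F p) v = (v *m fu F p) 0 0;
  V_dual : forall p v, O p -> gdot g p (fV F p) v = (v *m fv F p) 0 0;
  u_U : forall p, O p -> pair1 (fu F) (fU F) p = 1;
  fH_def : forall p, O p -> fH F p = Jtensor M p *m fG F p;
  GJ_anti : forall p, O p ->
    Jtensor M p *m fG F p = - (fG F p *m Jtensor M p);
  G_sqr : forall p, O p ->
    fG F p *m fG F p = - 1%:M + fu F p *m fU F p + fv F p *m fV F p;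
  H_sqr : forall p, O p ->
    fH F p *m fH F p = - 1%:M + fu F p *m fU F p + fv F p *m fV F p;
  G_skew : forall p v w, O p ->
    gdot g p (v *m fG F p) w = - gdot g p v (w *m fG F p);
  G_U : forall p, O p -> act (fG F) (fU F) p = 0;
  du_eq : forall (O' : set M) X Y p, open O' -> O' `<=` O ->
    smooth_vf O' X -> smooth_vf O' Y -> O' p ->
    ext_deriv (fu F) X Y p = gdot g p (X p) (act (fG F) Y p)
      + wedge (sigma F) (pair1 (fv F)) X Y p;
  dv_eq : forall (O' : set M) X Y p, open O' -> O' `<=` O ->
    smooth_vf O' X -> smooth_vf O' Y -> O' p ->
    ext_deriv (fv F) X Y p = gdot g p (X p) (act (fH F) Y p)
      - wedge (sigma F) (pair1 (fu F)) X Y p }.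

Definition frame_compatible (O : set M) (F F' : frame M) : Prop :=
  exists a b : M -> R, [/\ smooth_fun O a, smooth_fun O b &
    forall p, O p ->
      a p ^+ 2 + b p ^+ 2 = 1 /\
      [/\ fu F' p = a p *: fu F p - b p *: fv F p,
          fv F' p = b p *: fu F p + a p *: fv F p,
          fG F' p = a p *: fG F p - b p *: fH F p &
          fH F' p = b p *: fG F p + a p *: fH F p]].

Definition contact_metric_structure (C : contact_structure M)
    (F : cindex C -> frame M) : Prop :=
  (forall i, contact_frame (cset i) (ctheta i) (F i)) /\
  (forall i j, frame_compatible (cset i `&` cset j) (F i) (F j)).

Definition tensorS (F : frame M) (X Y : vfield M) : vfield M := fun p =>
  let G := act (fG F) in let H := act (fH F) in let sg := sigma F in
  nijenhuis (fG F) X Y p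
  + (2 * gdot g p (X p) (G Y p)) *: fU F p
  - (2 * gdot g p (X p) (H Y p)) *: fV F p
  + 2 *: (pair1 (fv F) Y p *: H X p - pair1 (fv F) X p *: H Y p)
  + sg (G Y) p *: H X p - sg (G X) p *: H Y p
  + sg X p *: G (H Y) p - sg Y p *: G (H X) p.

Definition tensorT (F : frame M) (X Y : vfield M) : vfield M := fun p =>
  let G := act (fG F) in let H := act (fH F) in let sg := sigma F in
  nijenhuis (fH F) X Y p
  - (2 * gdot g p (X p) (G Y p)) *: fU F p
  + (2 * gdot g p (X p) (H Y p)) *: fV F p
  + 2 *: (pair1 (fu F) Y p *: G X p - pair1 (fu F) X p *: G Y p)
  + sg (H X) p *: G Y p - sg (H Y) p *: G X p
  + sg X p *: G (H Y) p - sg Y p *: G (H X) p.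

Definition horizontal (O : set M) (F : frame M) (X : vfield M) : Prop :=
  forall p, O p ->
    gdot g p (X p) (fU F p) = 0 /\ gdot g p (X p) (fV F p) = 0.

Definition normal_structure (C : contact_structure M) (F : cindex C -> frame M) : Prop :=
  forall i (O : set M), open O -> O `<=` cset i ->
    (forall X Y p, smooth_vf O X -> smooth_vf O Y ->
       horizontal O (F i) X -> horizontal O (F i) Y -> O p ->
       tensorS (F i) X Y p = 0 /\ tensorT (F i) X Y p = 0) /\
    (forall X p, smooth_vf O X -> O p ->
       tensorS (F i) (fU (F i)) X p = 0 /\ tensorT (F i) (fV (F i)) X p = 0).

End ContactMetric.

Section Submanifold.
Context {R : realType} {k m : nat} (M : manifold R k) (Mb : manifold R m).
Variables (g : Mb -> 'M[R]_m) (iota : M -> Mb).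

Definition smooth_map : Prop :=
  continuous iota /\
  forall p a, smooth_on (chart M p @` (dom M p `&` iota @^-1` dom Mb a))
    (chart Mb a \o iota \o unchart M p).

Definition dmap (p : M) : 'M[R]_(k, m) :=
  'J (chart Mb (iota p) \o iota \o unchart M p) (chart M p p).

Definition immersed_submanifold : Prop :=
  [/\ smooth_map, injective iota & forall p, row_free (dmap p)].

(* Subspaces of the ambient tangent space at iota p are row spaces. *)
Definition tangent (p : M) : 'M[R]_m := <<dmap p>>%MS.

Definition orth (p : M) (E : 'M[R]_m) : 'M[R]_m := kermx (g (iota p) *m E^T).

Definition radical (p : M) : 'M[R]_m :=
  (tangent p :&: orth p (tangent p))%MS.

Definition smooth_along (W : set M) (s : M -> 'rV[R]_m) : Prop :=
  forall (O : set Mb) (f : Mb -> R), open O -> smooth_fun O f ->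
    smooth_fun (W `&` iota @^-1` O) (fun p => dfun f (iota p) (s p)).

Definition local_basis (r : nat) (E : M -> 'M[R]_m) (W : set M)
    (s : 'I_r -> M -> 'rV[R]_m) : Prop :=
  (forall i, smooth_along W (s i)) /\
  (forall p, W p -> row_free (\matrix_(i < r) s i p) /\
     (E p :=: \matrix_(i < r) s i p)%MS).

Definition smooth_distribution (r : nat) (E : M -> 'M[R]_m) : Prop :=
  forall p, exists (W : set M) (s : 'I_r -> M -> 'rV[R]_m),
    [/\ open W, W p & local_basis E W s].

Definition null_submanifold (r : nat) : Prop :=
  (0 < r)%N /\ smooth_distribution r radical.

Definition nondegenerate_on (p : M) (E : 'M[R]_m) : Prop :=
  (E :&: orth p E)%MS = 0.

(* E is a nondegenerate subbundle of A with A = Rad TM _|_ E. *)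
Definition complement_of_radical (A E : M -> 'M[R]_m) : Prop :=
  (exists s, smooth_distribution s E) /\
  forall p, [/\ nondegenerate_on p (E p), (radical p :&: E p)%MS = 0,
    (E p <= orth p (radical p))%MS & (radical p + E p :=: A p)%MS].

Definition screen (Sc : M -> 'M[R]_m) : Prop :=
  complement_of_radical tangent Sc.

Definition screen_transversal (St : M -> 'M[R]_m) : Prop :=
  complement_of_radical (fun p => orth p (tangent p)) St.

Definition null_transversal (r : nat) (Sc St L : M -> 'M[R]_m) : Prop :=
  forall p, exists (W : set M) (xi N : 'I_r -> M -> 'rV[R]_m),
    [/\ open W, W p, local_basis radical W xi, local_basis L W N &
      forall x, W x -> forall i j,
        [/\ (N i x <= orth x (Sc x))%MS, (N i x <= orth x (St x))%MS,
            gdot g (iota x) (xi i x) (N j x) = (i == j)%:R &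
            gdot g (iota x) (N i x) (N j x) = 0]].

(* w is the value at p of the ambient covariant derivative of Y along X,
   computed with local extensions of X and Y around iota p. *)
Definition ambient_nabla (D : vfield Mb -> vfield Mb -> vfield Mb)
    (X Y : vfield M) (p : M) (w : 'rV[R]_m) : Prop :=
  exists (W : set M) (O : set Mb) (Xb Yb : vfield Mb),
    [/\ open W /\ W p, open O, smooth_vf O Xb /\ smooth_vf O Yb,
        forall x, W x -> [/\ O (iota x), Xb (iota x) = X x *m dmap x &
                             Yb (iota x) = Y x *m dmap x] &
        w = D Xb Yb (iota p)].

(* Components in ltr(TM) and S(TM^perp) for the decomposition
   TM + ltr(TM) + S(TM^perp). *)
Definition ltr_part (St L : M -> 'M[R]_m) (p : M) (w : 'rV[R]_m) : 'rV[R]_m :=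
  w *m proj_mx (L p) (tangent p + St p)%MS.

Definition str_part (St L : M -> 'M[R]_m) (p : M) (w : 'rV[R]_m) : 'rV[R]_m :=
  w *m proj_mx (St p) (tangent p + L p)%MS.

(* h^l(X, Y) = 0 and h^s(X, Y) = 0, for sections X, Y of TM over any open
   subset of M. *)
Definition totally_geodesic (D : vfield Mb -> vfield Mb -> vfield Mb)
    (St L : M -> 'M[R]_m) : Prop :=
  forall (O : set M) (X Y : vfield M) p w, open O ->
    smooth_vf O X -> smooth_vf O Y -> O p -> ambient_nabla D X Y p w ->
    ltr_part St L p w = 0 /\ str_part St L p w = 0.

End Submanifold.

Definition quaternion_submanifold (R : realType) (n k : nat)
    (Mb : complex_manifold R n.*2.+1) (C : contact_structure Mb)
    (F : cindex C -> frame Mb) (g : Mb -> 'M[R]_(n.*2.+1 + n.*2.+1))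
    (M : manifold R k) (iota : M -> Mb)
    (Sc : M -> 'M[R]_(n.*2.+1 + n.*2.+1)) : Prop :=
  forall i p, cset i (iota p) ->
    let Rad := radical g iota p in
    [/\ (fU (F i) (iota p) <= Sc p)%MS, (fV (F i) (iota p) <= Sc p)%MS,
        [/\ stablemx Rad (J0 n.*2.+1), stablemx Rad (fG (F i) (iota p)) &
            stablemx Rad (fH (F i) (iota p))] &
        [/\ stablemx (Sc p) (J0 n.*2.+1), stablemx (Sc p) (fG (F i) (iota p)) &
            stablemx (Sc p) (fH (F i) (iota p))]].

(* Main.v *)
(* The second fundamental form h takes values in the quotient by TM, so it is
   tested against vectors z orthogonal to TM; these are horizontal, and both TM
   and its orthogonal are stable under G and H.  Normality gives
   nabla_X U = - G X and nabla_X V = - H X up to vertical terms, hence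
   h(X, U) = h(X, V) = 0, and on horizontal fields
   (nabla_X G) Y = sigma(X) H Y, (nabla_X H) Y = - sigma(X) G Y up to vertical
   terms, hence h(X, G Y) = G h(X, Y) and h(X, H Y) = H h(X, Y).  As h is symmetric,
   h(G X, H Y) equals both G H h(X, Y) and H G h(X, Y) = - G H h(X, Y), so h = 0.

   The formula for nabla G is obtained as in the proof that an almost Kaehler
   manifold with integrable structure is Kaehler: the error term
   g((nabla_X G) Y - sigma(X) H Y, Z) is skew in (Y, Z), has vanishing cyclic sum
   because d(du) = 0, and satisfies a third identity because S = 0; together these
   force it to vanish.  For horizontal arguments d(sigma) does not enter. *)
From mathcomp Require Import all_boot all_order all_algebra.
From mathcomp Require Import all_classical all_reals all_analysis.
From mathcomp Require Import ring lra.
Require Import Defs.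

Set Implicit Arguments.
Unset Strict Implicit.
Unset Printing Implicit Defensive.

Import Order.TTheory GRing.Theory Num.Theory.
Import numFieldNormedType.Exports.

Local Open Scope classical_set_scope.
Local Open Scope ring_scope.

(** * Maps of class C^k *)

(** The formula for nabla_X U rests on S(U, X) = 0: it says that the bracket with U commutes with G
    on horizontal fields up to a multiple of H. With it, d(du) = 0 evaluated on (U, X, Y) becomes
    the Killing equation for U on horizontal vectors; the symmetric part of nabla U is then 0 and du
    gives the skew part. The symmetry of h is the analytic obstacle. It needs the bracket of two
    ambient fields tangent along M to be tangent, while their components along M are only shown to
    be continuous. The bracket is therefore tested on functions whose restriction to M is critical
    at the point: iterated derivatives of such a function reduce to a Hessian on M, which is
    symmetric. Degeneracy of the induced metric does no harm: the ambient metric is nondegenerate,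
    so TM is the orthogonal of its orthogonal, and a vector with no product against normal vectors
    is tangent. The screen and transversal bundles come in only at the two ends, to split TM into
    invariant pieces and to project. *)

Section CkCalculus.
Context {R : realType} {V : normedModType R}.

Lemma near_open (A : set V) (x : V) (P : V -> Prop) :
  open A -> A x -> (forall y, A y -> P y) -> \forall y \near x, P y.
Proof. by move=> oA Ax AP; apply: filterS AP _; exact: open_nbhs_nbhs. Qed.

(** The difference [d] vanishes near [x], so it has a first-order expansion with zero linear part;
    adding it to [f] carries differentiability over to [g]. *)
Lemma near_eq_differentiable (W : normedModType R) (f g : V -> W) (x : V) :
  (\forall y \near x, f y = g y) -> differentiable f x -> differentiable g x.
Proof.
move=> fg df; pose d : V -> W := fun y => g y - f y.
suff dd : differentiable d x.
  have -> : g = f + d by apply/funext => y; rewrite /d fctE addrC subrK.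
  exact: differentiableD.
have d0 : \forall y \near x, d y = 0.
  by apply: filterS fg => y; rewrite /d => ->; rewrite subrr.
have dx : d x = 0 by exact: nbhs_singleton d0.
pose z : {linear V -> W} := \0%R.
have zc : continuous z by exact: cst_continuous.
have dE : d \o shift x = cst (d x) + z +o_ 0 id.
  apply/eqaddoP => e e0; near=> y.
  rewrite /= !fctE /= dx addr0 subr0.
  suff -> : d (y + x) = 0 by rewrite normr0 mulr_ge0 // ltW.
  by near: y; move: d0; rewrite (near_shift 0 x) /= subr0.
have E := diff_unique zc dE.
by apply/diff_locallyP; rewrite E; split.
Unshelve. all: by end_near. Qed.

Lemma Ck_sub (W : normedModType R) k (A B : set V) (f : V -> W) :
  B `<=` A -> Ck k A f -> Ck k B f.
Proof.
elim: k f => [|k IH] f BA /=; first by move=> cf x /BA; exact: cf.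
by move=> [df cf]; split=> [x /BA|v]; [exact: df|exact: IH].
Qed.

Lemma Ck_eq (W : normedModType R) k (A : set V) (f g : V -> W) :
  open A -> (forall x, A x -> f x = g x) -> Ck k A f -> Ck k A g.
Proof.
move=> oA; elim: k f g => [|k IH] f g fg /=.
  move=> cf x Ax; rewrite /prop_for /continuous_at -(fg _ Ax).
  apply: cvg_trans (cf _ Ax); apply: near_eq_cvg.
  exact: near_open oA Ax fg.
move=> [df cf]; split=> [x Ax|v].
  by apply: near_eq_differentiable (df _ Ax); exact: near_open oA Ax fg.
apply: IH (cf v) => x Ax; apply: near_eq_derive.
exact: near_open oA Ax fg.
Qed.

Lemma Ck_continuous (W : normedModType R) k (A : set V) (f : V -> W) x :
  Ck k A f -> A x -> {for x, continuous f}.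
Proof.
case: k => [|k] /=; first by move=> cf; exact: cf.
by move=> [df _] /df; exact: differentiable_continuous.
Qed.

Lemma CkS (W : normedModType R) k (A : set V) (f : V -> W) :
  Ck k.+1 A f -> Ck k A f.
Proof.
elim: k f => [|k IH] f; first by move=> cf x; exact: Ck_continuous cf.
by move=> [df cf]; split=> // v; exact: IH.
Qed.

Lemma Ck_cst (W : normedModType R) k (A : set V) (c : W) : Ck k A (fun=> c).
Proof.
elim: k c => [|k IH] c /=; first by move=> x _; exact: cst_continuous.
split=> [x _|v]; first exact: differentiable_cst.
suff -> : (fun x => 'D_v (fun=> c) x) = (fun=> 0 : W) by exact: IH.
by apply/funext => x; rewrite derive_cst.
Qed.

Lemma CkD (W : normedModType R) k (A : set V) (f g : V -> W) :
  open A -> Ck k A f -> Ck k A g -> Ck k A (fun x => f x + g x).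
Proof.
move=> oA; elim: k f g => [|k IH] f g /=.
  by move=> cf cg x Ax; apply: cvgD; [exact: cf|exact: cg].
move=> [df cf] [dg cg]; split=> [x Ax|v].
  by apply: differentiableD; [exact: df|exact: dg].
apply: (Ck_eq oA _ (IH _ _ (cf v) (cg v))) => x Ax.
by rewrite deriveD //; apply: diff_derivable; [exact: df|exact: dg].
Qed.

Lemma CkM k (A : set V) (f g : V -> R) :
  open A -> Ck k A f -> Ck k A g -> Ck k A (fun x => f x * g x).
Proof.
move=> oA; elim: k f g => [|k IH] f g Cf Cg.
  by move=> x Ax; apply: cvgM; [exact: Cf|exact: Cg].
case: (Cf) (Cg) => [df cf] [dg cg]; split=> [x Ax|v].
  by apply: differentiableM; [exact: df|exact: dg].
(* Each Leibniz term keeps one undifferentiated factor, which is used one order lower, hence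
   [CkS]. *)
have := CkD oA (IH _ _ (CkS Cf) (cg v)) (IH _ _ (CkS Cg) (cf v)).
apply: (Ck_eq oA) => x Ax.
by rewrite deriveM //; apply: diff_derivable; [exact: df|exact: dg].
Qed.

Lemma Ck_sum k (A : set V) n (f : 'I_n -> V -> R) :
  open A -> (forall i, Ck k A (f i)) -> Ck k A (fun x => \sum_(i < n) f i x).
Proof.
move=> oA cf; elim: n f cf => [|n IH] f cf.
  by apply: (Ck_eq oA _ (Ck_cst _ _ 0)) => x _; rewrite big_ord0.
apply: (Ck_eq oA _ (CkD oA (IH _ (fun i => cf (widen_ord (leqnSn n) i))) (cf ord_max))).
by move=> x _; rewrite big_ord_recr.
Qed.

Lemma derive_coord m (f : V -> 'rV[R]_m) x v j :
  derivable f x v -> 'D_v (fun y => f y 0 j) x = ('D_v f x) 0 j.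
Proof. by move=> df; rewrite derive_mx // mxE. Qed.

Lemma differentiable_comp_coord m (f : V -> 'rV[R]_m) x j :
  differentiable f x -> differentiable (fun y => f y 0 j) x.
Proof.
move=> df.
exact: (differentiable_comp df (differentiable_coord (f x) 0 j)).
Qed.

Lemma Ck_coord k (A : set V) m (f : V -> 'rV[R]_m) j :
  open A -> Ck k A f -> Ck k A (fun x => f x 0 j).
Proof.
move=> oA; elim: k f => [|k IH] f /=.
  move=> cf x Ax.
  apply: (@continuous_comp _ _ _ f (fun y : 'rV[R]_m => y 0 j)).
    exact: cf.
  exact: coord_continuous.
move=> [df cf]; split=> [x Ax|v].
  by apply: differentiable_comp_coord; exact: df.
apply: (Ck_eq oA _ (IH _ (cf v))) => x Ax.
by rewrite derive_coord //; apply: diff_derivable; exact: df.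
Qed.

End CkCalculus.

(** * Chain rule *)

Section ChainRule.
Context {R : realType}.

Lemma derive_comp (U V W : normedModType R) (f : U -> V) (h : V -> W) x v :
  differentiable f x -> differentiable h (f x) ->
  'D_v (h \o f) x = 'D_('D_v f x) h (f x).
Proof.
move=> df dh; have dhf := differentiable_comp df dh.
by rewrite (deriveE _ dhf) diff_comp //= (deriveE _ dh) (deriveE _ df).
Qed.

(** In [derive_comp] the outer direction moves with [x]. Here the outer derivatives have fixed
    directions, as in the recursion defining [Ck], so the formula can be iterated in [Ck_comp]. *)
Lemma derive_comp_rV (V : normedModType R) n (f : V -> 'rV[R]_n)
    (h : 'rV[R]_n -> R) x v :
  differentiable f x -> differentiable h (f x) ->
  'D_v (h \o f) x
    = \sum_(j < n) 'D_v (fun y => f y 0 j) x * 'D_(delta_mx 0 j) h (f x).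
Proof.
move=> df dh; have dhf := differentiable_comp df dh.
rewrite deriveE // diff_comp //= -(deriveE v df) [X in 'd h _ X]row_sum_delta.
rewrite linear_sum; apply: eq_bigr => j _.
by rewrite linearZ -deriveE // derive_coord //; exact: diff_derivable.
Qed.

Lemma derive_rV n (h : 'rV[R]_n -> R) x v : differentiable h x ->
  'D_v h x = \sum_(j < n) v 0 j * 'D_(delta_mx 0 j) h x.
Proof.
move=> dh; rewrite deriveE // [X in 'd h _ X]row_sum_delta linear_sum.
by apply: eq_bigr => j _; rewrite linearZ -deriveE.
Qed.

Lemma Ck_comp (V : normedModType R) n k (A : set V) (B : set 'rV[R]_n)
    (f : V -> 'rV[R]_n) (h : 'rV[R]_n -> R) :
  open A -> (forall x, A x -> B (f x)) ->
  Ck k A f -> Ck k B h -> Ck k A (h \o f).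
Proof.
move=> oA AB; elim: k h => [|k IH] h Cf Ch.
  by move=> x Ax; apply: continuous_comp; [exact: Cf|exact/Ch/AB].
case: (Cf) (Ch) => [df cf] [dh ch]; split=> [x Ax|v].
  by apply: differentiable_comp; [exact: df|exact/dh/AB].
apply: (@Ck_eq _ _ _ _ _ (fun x => \sum_(j < n)
    'D_v (fun y => f y 0 j) x * ('D_(delta_mx 0 j) h \o f) x)) => // [x Ax|].
  by rewrite derive_comp_rV //; [exact: df|exact/dh/AB].
apply: Ck_sum => // j; apply: CkM => //; last exact: IH (CkS Cf) (ch _).
by have [_] := Ck_coord j oA Cf; apply.
Qed.

End ChainRule.

(** * Symmetry of second derivatives *)

Lemma close_ler (R : realType) (a b c d e : R) :
  `|a - c| < e / 2 -> `|b - d| < e / 2 -> c = d -> `|a - b| <= e.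
Proof.
move=> h1 h2 E; rewrite -{}E in h2; rewrite -(subrKA c) (splitr e) (le_trans (ler_normD _ _)) //.
by rewrite lerD // ltW // distrC.
Qed.

Lemma eq_of_close (R : realType) (a b : R) :
  (forall e, 0 < e -> `|a - b| <= e) -> a = b.
Proof.
move=> h; apply/eqP; rewrite -subr_eq0 -normr_le0; apply/ler_addgt0Pr => e e0.
by rewrite add0r h.
Qed.

Section Schwarz.
Context {R : realType} {V : normedModType R}.
Implicit Types (f : V -> R) (x y v w : V).
Lemma is_derive_line f y v (s : R) : differentiable f (y + s *: v) ->
  is_derive s 1 (fun r : R => f (y + r *: v)) ('D_v f (y + s *: v)).
Proof.
move=> df; pose l : R -> V := fun r => y + r *: v.
have dl : is_diff s l (fun r => r *: v).
  apply: is_diff_eq (is_diffD (g := fun r : R => r *: v) _ _) _.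
  by apply/funext => r; rewrite !fctE add0r.
have dls : differentiable l s by exact: ex_diff.
have dfl : differentiable (f \o l) s by exact: differentiable_comp.
apply: DeriveDef; first exact: diff_derivable.
rewrite (deriveE _ dfl) diff_comp //= (deriveE _ df).
by rewrite (diff_val (f := l)) scale1r.
Qed.
(** The mean value theorem is applied along [v] to the increment of [f] in direction [w], then along
    [w] to the derivative so obtained. The second difference is symmetric in [v] and [w], so
    exchanging them compares the two mixed derivatives. *)
Lemma second_difference (A : set V) f x v w (t : R) : 0 < t ->
  (forall a b : R, 0 <= a <= t -> 0 <= b <= t -> A (x + a *: v + b *: w)) ->
  (forall y, A y -> differentiable f y) ->
  (forall y, A y -> differentiable (fun z => 'D_v f z) y) ->
  exists a b : R, [/\ 0 <= a <= t, 0 <= b <= t &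
    f (x + t *: v + t *: w) - f (x + t *: v) - (f (x + t *: w) - f x)
      = t * (t * 'D_w (fun z => 'D_v f z) (x + a *: v + b *: w))].
Proof.
move=> t0 At df ddf.
have tt : 0 <= t <= t by rewrite lexx ltW.
have t00 : 0 <= (0 : R) <= t by rewrite lexx ltW.
pose phi (s : R) := f (x + t *: w + s *: v) - f (x + s *: v).
have E b s : x + b *: w + s *: v = x + s *: v + b *: w by rewrite addrAC.
have A1 s : 0 <= s <= t -> A (x + t *: w + s *: v) by move=> ?; rewrite E; exact: At.
have A2 s : 0 <= s <= t -> A (x + s *: v).
  by move=> hs; have := At s 0 hs t00; rewrite scale0r addr0.
have dphi s : 0 <= s <= t ->
    is_derive s 1 phi ('D_v f (x + t *: w + s *: v) - 'D_v f (x + s *: v)).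
  move=> hs; apply: is_deriveB; apply: is_derive_line; apply: df.
    exact: A1.
  exact: A2.
have [a] := @MVT_segment R phi
  (fun s => 'D_v f (x + t *: w + s *: v) - 'D_v f (x + s *: v)) 0 t (ltW t0)
  (fun s hs => dphi s ltac:(by move: hs; rewrite in_itv /= => /andP[/ltW -> /ltW ->]))
  ltac:(by apply: derivable_within_continuous => s; rewrite in_itv /= => /dphi []).
rewrite in_itv /= => ha; rewrite /phi !scale0r !addr0 !subr0 => Ephi.
have dpsi s : 0 <= s <= t -> is_derive s 1 (fun r => 'D_v f (x + a *: v + r *: w))
    ('D_w (fun z => 'D_v f z) (x + a *: v + s *: w)).
  by move=> hs; apply: (is_derive_line (f := fun z => 'D_v f z)); apply/ddf/At.
have [b] := @MVT_segment R (fun r => 'D_v f (x + a *: v + r *: w))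
  (fun s => 'D_w (fun z => 'D_v f z) (x + a *: v + s *: w)) 0 t (ltW t0)
  (fun s hs => dpsi s ltac:(by move: hs; rewrite in_itv /= => /andP[/ltW -> /ltW ->]))
  ltac:(by apply: derivable_within_continuous => s; rewrite in_itv /= => /dpsi []).
rewrite in_itv /= => hb; rewrite scale0r addr0 subr0 => Epsi.
exists a, b; split => //.
move: Ephi; rewrite !E Epsi => Ephi.
rewrite Ephi; ring.
Qed.
(** Both orders compute the same second difference, so the mixed derivatives agree at two points of
    an arbitrarily small parallelogram at [x]; continuity brings the equality to [x]. *)
Lemma derive_swap (A : set V) f x v w : open A -> A x -> Ck 2 A f ->
  'D_v (fun y => 'D_w f y) x = 'D_w (fun y => 'D_v f y) x.
Proof.
move=> oA Ax [df Cf].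
have [dvf /(_ w) Cvw] := Cf v; have [dwf /(_ v) Cwv] := Cf w.
have {}Cvw := Cvw _ Ax; have {}Cwv := Cwv _ Ax.
set L1 := LHS; set L2 := RHS.
apply: eq_of_close => e e0.
pose P (y : V) := [/\ A y,
  `|L1 - 'D_v (fun y => 'D_w f y) y| < e / 2 &
  `|L2 - 'D_w (fun y => 'D_v f y) y| < e / 2].
have nP : \forall y \near x, P y.
  have e2 : 0 < e / 2 by rewrite divr_gt0.
  have n1 := (cvgrPdist_lt _ _).1 Cwv _ e2.
  have n2 := (cvgrPdist_lt _ _).1 Cvw _ e2.
  have n3 : nbhs x A by exact: open_nbhs_nbhs.
  apply: filterS (filterI n3 (filterI (n1 _) (n2 _))) => y [Ay [h1 h2]].
  exact: (And3 Ay h1 h2).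
case/nbhs_ballP: nP => d /= d0 dP.
(* The summand 1 keeps [s] positive when [v] and [w] are both 0. With [t] equal to [d / 2 / s], the
   parallelogram stays in the ball of radius [d] on which [P] holds. *)
pose s := `|v| + `|w| + 1.
have s0 : 0 < s by rewrite ltr_wpDl // addr_ge0.
pose t := d / 2 / s.
have t0 : 0 < t by rewrite !divr_gt0.
have At a b : 0 <= a <= t -> 0 <= b <= t -> P (x + a *: v + b *: w).
  move=> /andP[a0 at_] /andP[b0 bt]; apply: dP.
  rewrite -ball_normE /ball_ /= -addrA opprD addNKr normrN.
  apply: (le_lt_trans (ler_normD _ _)); rewrite !normrZ !ger0_norm //.
  apply: (@le_lt_trans _ _ (t * (`|v| + `|w|))).
    by rewrite mulrDr lerD // ler_wpM2r.
  apply: (@lt_trans _ _ (t * s)); first by rewrite ltr_pM2l // /s ltrDl.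
  by rewrite /t divfK ?gt_eqF // ltr_pdivrMr // mulr_natr mulr2n ltrDr.
have [a [b [ha hb E1]]] := @second_difference A f x v w t t0
  (fun a b ha hb => let: And3 h _ _ := At a b ha hb in h) df dvf.
have At' a' b' : 0 <= a' <= t -> 0 <= b' <= t -> P (x + a' *: w + b' *: v).
  by move=> ha' hb'; rewrite addrAC; exact: At.
have [a' [b' [ha' hb' E2]]] := @second_difference A f x w v t t0
  (fun a b ha hb => let: And3 h _ _ := At' a b ha hb in h) df dwf.
have E : 'D_w (fun z => 'D_v f z) (x + a *: v + b *: w)
    = 'D_v (fun z => 'D_w f z) (x + a' *: w + b' *: v).
  apply: (mulfI (lt0r_neq0 t0)); apply: (mulfI (lt0r_neq0 t0)).
  apply: (etrans (esym E1)); apply: etrans E2.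
  rewrite (addrAC x (t *: w)) !opprB -!addrA; congr (_ + _).
  by rewrite addrCA [RHS]addrCA; congr (_ + _); exact: addrC.
have [_ _ h1] := At _ _ ha hb; have [_ h2 _] := At' _ _ ha' hb'.
exact: close_ler h2 h1 (esym E).
Qed.
End Schwarz.

(** * Vector fields and brackets on a manifold *)

Lemma alternating_sum0 (R : comPzRingType) (a b c d e f : R) :
  a - b - (c - d) + (e - d - (a - f)) + (c - f - (e - b)) = 0.
Proof. ring. Qed.

Section ManifoldCalculus.
Context {R : realType} {m : nat} (M : manifold R m).
Implicit Types (O : set M) (f : M -> R) (X Y Z : vfield M) (p q : M).

Lemma open_chart O p : open O -> open (chart M p @` (dom M p `&` O)).
Proof.
move=> oO; rewrite openE => x [q [dq Oq] <-].
have dx : (chart M p @` dom M p) (chart M p q) by exists q.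
have n1 : nbhs (chart M p q) (chart M p @` dom M p).
  by apply: open_nbhs_nbhs; split=> //; exact: chart_open.
have n2 : nbhs (chart M p q) (unchart M p @^-1` O).
  apply: (unchart_continuous dx); rewrite chartK //.
  exact: open_nbhs_nbhs.
apply: filterS2 n1 n2 => y [q' dq' <-]; rewrite /= chartK // => Oq'.
by exists q'.
Qed.

Arguments open_chart {O} p.

Lemma smooth_fun_sub O O' f : O' `<=` O -> smooth_fun O f -> smooth_fun O' f.
Proof.
move=> sub sf p k; apply: Ck_sub (sf p k) => x [q [dq Oq] <-].
by exists q => //; split=> //; exact: sub.
Qed.

Lemma smooth_fun_eq O f g : open O -> (forall p, O p -> f p = g p) ->
  smooth_fun O f -> smooth_fun O g.
Proof.
move=> oO fg sf p k; apply: Ck_eq (sf p k); first exact: open_chart.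
by move=> x [q [dq Oq] <-] /=; rewrite chartK // fg.
Qed.

Lemma smooth_fun_cst O (c : R) : smooth_fun O (fun=> c).
Proof. by move=> p k; exact: Ck_cst. Qed.

Lemma smooth_funD O f g : open O -> smooth_fun O f -> smooth_fun O g ->
  smooth_fun O (fun x => f x + g x).
Proof. by move=> oO sf sg p k; exact: (CkD (open_chart p oO) (sf p k) (sg p k)). Qed.

Lemma smooth_funM O f g : open O -> smooth_fun O f -> smooth_fun O g ->
  smooth_fun O (fun x => f x * g x).
Proof. by move=> oO sf sg p k; exact: (CkM (open_chart p oO) (sf p k) (sg p k)). Qed.

Lemma smooth_funN O f : open O -> smooth_fun O f -> smooth_fun O (fun x => - f x).
Proof.
move=> oO sf; have := smooth_funM oO (smooth_fun_cst O (-1)) sf.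
by apply: smooth_fun_eq => // p _; rewrite mulN1r.
Qed.

Lemma smooth_funB O f g : open O -> smooth_fun O f -> smooth_fun O g ->
  smooth_fun O (fun x => f x - g x).
Proof. by move=> oO sf sg; apply: smooth_funD => //; exact: smooth_funN. Qed.

Lemma smooth_fun_differentiable O f p q : smooth_fun O f -> O q -> dom M p q ->
  differentiable (f \o unchart M p) (chart M p q).
Proof. by move=> sf Oq dq; have [+ _] := sf p 1; apply; exists q. Qed.

Lemma near_chart O p q (P : 'rV[R]_m -> Prop) : open O -> O q -> dom M p q ->
  (forall q', dom M p q' -> O q' -> P (chart M p q')) ->
  \forall x \near chart M p q, P x.
Proof.
move=> oO Oq dq OP; apply: (near_open (open_chart p oO)); first by exists q.
by move=> _ [q' [dq' Oq'] <-]; exact: OP.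
Qed.

Lemma dfun_eq O f g p v : open O -> O p -> (forall q, O q -> f q = g q) ->
  dfun f p v = dfun g p v.
Proof.
move=> oO Op fg; apply: near_eq_derive.
apply: (near_chart oO Op (dom_self p)) => q dq Oq /=.
by rewrite chartK // fg.
Qed.

(** A tangent vector at [q] is stored by its components in [chart M q]; the numbers
    [dfun (coord p j) q v] are its components in [chart M p]. *)
Lemma dfun_chart O f p q v : open O -> O q -> dom M p q -> smooth_fun O f ->
  dfun f q v = \sum_(j < m) dfun (coord p j) q v
                 * 'D_(delta_mx 0 j) (f \o unchart M p) (chart M p q).
Proof.
move=> oO Oq dq sf; pose t := chart M p \o unchart M q.
have tq : t (chart M q q) = chart M p q by rewrite /t /= chartK //; exact: dom_self.
have dt : differentiable t (chart M q q).
  have [+ _] := @transition_smooth _ _ M q p 1; apply.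
  by exists q => //; split=> //; exact: dom_self.
transitivity ('D_v ((f \o unchart M p) \o t) (chart M q q)).
  apply: near_eq_derive; apply: (near_chart (dom_open p) dq (dom_self q)).
  by move=> q' dq' pq' /=; rewrite /t /= !chartK.
have df : differentiable (f \o unchart M p) (t (chart M q q)).
  by rewrite tq; exact: smooth_fun_differentiable sf Oq dq.
by rewrite (derive_comp_rV _ dt df) tq.
Qed.

Lemma smooth_coord p j : smooth_fun (dom M p) (coord p j).
Proof.
move=> q k; apply: (Ck_coord (f := chart M p \o unchart M q)).
  by apply: open_chart; exact: dom_open.
exact: transition_smooth.
Qed.

Lemma derive_chart_id p v : 'D_v (chart M p \o unchart M p) (chart M p p) = v.
Proof.
transitivity ('D_v id (chart M p p)); last by rewrite derive_id.
apply: near_eq_derive; apply: (near_chart (dom_open p)); try exact: dom_self.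
by move=> q dq _ /=; rewrite chartK.
Qed.

Lemma dfun_coord p j v : dfun (coord p j) p v = v 0 j.
Proof.
rewrite /dfun -[in RHS](derive_chart_id p v) -derive_coord //.
apply: diff_derivable; have [+ _] := @transition_smooth _ _ M p p 1; apply.
by exists p => //; split; exact: dom_self.
Qed.

Lemma dfunDv O f p v w : O p -> smooth_fun O f ->
  dfun f p (v + w) = dfun f p v + dfun f p w.
Proof.
move=> Op sf; have df := smooth_fun_differentiable sf Op (dom_self p).
by rewrite /dfun !deriveE // linearD.
Qed.

Lemma dfunZv O f p a v : O p -> smooth_fun O f ->
  dfun f p (a *: v) = a * dfun f p v.
Proof.
move=> Op sf; have df := smooth_fun_differentiable sf Op (dom_self p).
by rewrite /dfun !deriveE // linearZ.
Qed.

Lemma dfunD O f g p v : O p -> smooth_fun O f -> smooth_fun O g ->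
  dfun (fun x => f x + g x) p v = dfun f p v + dfun g p v.
Proof.
move=> Op sf sg; rewrite /dfun -deriveD //; apply: diff_derivable.
  exact: smooth_fun_differentiable sf Op (dom_self p).
exact: smooth_fun_differentiable sg Op (dom_self p).
Qed.

Lemma dfunM O f g p v : O p -> smooth_fun O f -> smooth_fun O g ->
  dfun (fun x => f x * g x) p v = f p * dfun g p v + g p * dfun f p v.
Proof.
move=> Op sf sg; rewrite /dfun.
transitivity ('D_v ((f \o unchart M p) * (g \o unchart M p)) (chart M p p)) => //.
rewrite deriveM /= ?chartK //; try exact: dom_self; apply: diff_derivable.
  exact: smooth_fun_differentiable sf Op (dom_self p).
exact: smooth_fun_differentiable sg Op (dom_self p).
Qed.

Lemma dfun_cst c p v : dfun (fun=> c) p v = 0 :> R.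
Proof. exact: derive_cst. Qed.

Lemma dfunB O f g p v : open O -> O p -> smooth_fun O f -> smooth_fun O g ->
  dfun (fun x => f x - g x) p v = dfun f p v - dfun g p v.
Proof.
move=> oO Op sf sg; rewrite (dfunD _ Op sf (smooth_funN oO sg)); congr (_ + _).
transitivity (dfun (fun x => (-1) * g x) p v).
  by congr (dfun _ p v); apply/funext => x; rewrite mulN1r.
by rewrite (dfunM _ Op (smooth_fun_cst _ _) sg) dfun_cst mulr0 addr0 mulN1r.
Qed.

Lemma smooth_vf_sub O O' X : O' `<=` O -> smooth_vf O X -> smooth_vf O' X.
Proof.
by move=> sub sX U f oU UO; apply: sX => //; exact: subset_trans UO sub.
Qed.

Lemma smooth_lie_deriv O X f : open O -> smooth_vf O X -> smooth_fun O f ->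
  smooth_fun O (lie_deriv X f).
Proof. by move=> oO sX; exact: sX. Qed.

Lemma smooth_vf_eq O X Y : (forall p, O p -> X p = Y p) ->
  smooth_vf O X -> smooth_vf O Y.
Proof.
move=> XY sX O' f oO' OO' sf; apply: smooth_fun_eq (sX _ _ oO' OO' sf) => //.
by move=> p /OO' Op; rewrite /lie_deriv XY.
Qed.

Lemma smooth_vfD O X Y : smooth_vf O X -> smooth_vf O Y ->
  smooth_vf O (fun x => X x + Y x).
Proof.
move=> sX sY O' f oO' OO' sf.
have := smooth_funD oO' (sX _ _ oO' OO' sf) (sY _ _ oO' OO' sf).
by apply: smooth_fun_eq => // p Op; rewrite /lie_deriv (dfunDv _ _ Op sf).
Qed.

Lemma smooth_vfZ O a X : smooth_fun O a -> smooth_vf O X ->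
  smooth_vf O (fun x => a x *: X x).
Proof.
move=> sa sX O' f oO' OO' sf.
have := smooth_funM oO' (smooth_fun_sub OO' sa) (sX _ _ oO' OO' sf).
by apply: smooth_fun_eq => // p Op; rewrite /lie_deriv (dfunZv _ _ Op sf).
Qed.

Lemma smooth_vfN O X : smooth_vf O X -> smooth_vf O (fun x => - X x).
Proof.
move=> sX; apply: smooth_vf_eq (smooth_vfZ (smooth_fun_cst O (-1)) sX) => p _.
by rewrite scaleN1r.
Qed.

Lemma lie_deriv_chart O X f p q : open O -> O q -> dom M p q -> smooth_fun O f ->
  lie_deriv X f q = \sum_(j < m) lie_deriv X (coord p j) q
                 * 'D_(delta_mx 0 j) (f \o unchart M p) (chart M p q).
Proof. by move=> oO Oq dq sf; exact: (dfun_chart _ oO). Qed.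

Lemma smooth_vf_chart O X : open O ->
  (forall p j k, Ck k (chart M p @` (dom M p `&` O))
                   (lie_deriv X (coord p j) \o unchart M p)) ->
  smooth_vf O X.
Proof.
move=> oO sX O' f oO' OO' sf p k; have oc := open_chart p oO'.
have C j : Ck k (chart M p @` (dom M p `&` O'))
    (fun x => (lie_deriv X (coord p j) \o unchart M p) x
              * 'D_(delta_mx 0 j) (f \o unchart M p) x).
  apply: CkM => //; last by have [_] := sf p k.+1; apply.
  apply: Ck_sub (sX p j k) => _ [q [dq Oq] <-].
  by exists q => //; split=> //; exact: OO'.
apply: (Ck_eq oc) (Ck_sum oc C).
move=> _ [q [dq Oq] <-] /=; rewrite chartK //.
by rewrite (lie_deriv_chart _ oO' Oq dq sf).
Qed.

Lemma smooth_lie_deriv_coord O X p j : open O -> smooth_vf O X ->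
  smooth_fun (dom M p `&` O) (lie_deriv X (coord p j)).
Proof.
move=> oO sX; have oI : open (dom M p `&` O) by apply: openI => //; exact: dom_open.
apply: smooth_lie_deriv => //; first by apply: smooth_vf_sub sX => x [].
by apply: smooth_fun_sub (@smooth_coord p j) => x [].
Qed.

(** The first sum has X applied to the components of Y as coefficients; the last term is the Hessian
    of [f] in the chart, the part that cancels in a commutator. *)
Lemma lie_deriv2_chart O X Y f p : open O -> smooth_vf O Y -> smooth_fun O f -> O p ->
  lie_deriv X (lie_deriv Y f) p
  = \sum_(j < m) lie_deriv X (lie_deriv Y (coord p j)) p
        * 'D_(delta_mx 0 j) (f \o unchart M p) (chart M p p)
    + 'D_(Y p) (fun x => 'D_(X p) (f \o unchart M p) x) (chart M p p).
Proof.
move=> oO sY sf Op; set fh := f \o unchart M p; set x0 := chart M p p.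
have dp := @dom_self _ _ M p.
have oI : open (dom M p `&` O) by apply: openI => //; exact: dom_open.
have xin : (chart M p @` (dom M p `&` O)) x0 by exists p.
pose e j : 'rV[R]_m := delta_mx 0 j.
pose c j := lie_deriv Y (coord p j) \o unchart M p.
have dc j : differentiable (c j) x0.
  apply: (@smooth_fun_differentiable (dom M p `&` O)) => //.
  exact: smooth_lie_deriv_coord.
have [dfh Cfh] := sf p 2.
have dfhv v : differentiable (fun x => 'D_v fh x) x0 by have [+ _] := Cfh v; apply.
transitivity ('D_(X p) (\sum_(j < m) (c j * (fun x => 'D_(e j) fh x))) x0).
  rewrite /lie_deriv /dfun; apply: near_eq_derive.
  apply: (near_chart oO Op dp) => q dq Oq /=.
  rewrite chartK // -[LHS]/(lie_deriv Y f q) (lie_deriv_chart _ oO Oq dq sf) fct_sumE.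
  by apply: eq_bigr => j _; rewrite mulrfctE /c /= chartK.
rewrite derive_sum; last first.
  by move=> j; apply: derivableM; apply: diff_derivable.
rewrite [X in _ + X]derive_rV; last exact: dfhv.
rewrite -big_split /=; apply: eq_bigr => j _.
rewrite deriveM; [|exact: diff_derivable|exact: diff_derivable].
have -> : c j x0 = Y p 0 j by rewrite /c /= chartK // /lie_deriv dfun_coord.
rewrite (derive_swap _ _ (open_chart p oO) xin (sf p 2)).
apply: (etrans (addrC _ _)); apply: (f_equal2 +%R).
  exact: mulrC.
reflexivity.
Qed.

(** The bracket is defined by its action on coordinates only. On an arbitrary function the two
    Hessian terms agree by [derive_swap], and the first-order terms are the chart expression of the
    bracket. *)
Lemma lie_deriv_bracket O X Y f p : open O -> smooth_vf O X -> smooth_vf O Y ->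
  smooth_fun O f -> O p ->
  lie_deriv (bracket X Y) f p
  = lie_deriv X (lie_deriv Y f) p - lie_deriv Y (lie_deriv X f) p.
Proof.
move=> oO sX sY sf Op; have dp := @dom_self _ _ M p.
have xin : (chart M p @` (dom M p `&` O)) (chart M p p) by exists p.
rewrite (lie_deriv2_chart X oO sY sf Op) (lie_deriv2_chart Y oO sX sf Op).
rewrite (derive_swap (X p) (Y p) (open_chart p oO) xin (sf p 2)).
rewrite [X in _ - X]addrC addrKA.
rewrite -sumrB (lie_deriv_chart _ oO Op dp sf); apply: eq_bigr => j _.
by rewrite -mulrBl {1}/lie_deriv dfun_coord /bracket mxE.
Qed.

Lemma smooth_bracket O X Y : smooth_vf O X -> smooth_vf O Y ->
  smooth_vf O (bracket X Y).
Proof.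
move=> sX sY O' f oO' OO' sf.
have {}sX := smooth_vf_sub OO' sX; have {}sY := smooth_vf_sub OO' sY.
have sXf := smooth_lie_deriv oO' sX sf; have sYf := smooth_lie_deriv oO' sY sf.
have := smooth_funB oO' (smooth_lie_deriv oO' sX sYf) (smooth_lie_deriv oO' sY sXf).
by apply: smooth_fun_eq => // p Op; rewrite (lie_deriv_bracket oO').
Qed.

Lemma bracketE X Y p j : bracket X Y p 0 j
  = lie_deriv X (lie_deriv Y (coord p j)) p - lie_deriv Y (lie_deriv X (coord p j)) p.
Proof. exact: mxE. Qed.

Lemma lie_deriv_eq O X f g p : open O -> (forall q, O q -> f q = g q) -> O p ->
  lie_deriv X f p = lie_deriv X g p.
Proof. by move=> oO fg Op; exact: (dfun_eq _ oO). Qed.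

Lemma lie_derivB O X f g p : open O -> O p -> smooth_fun O f -> smooth_fun O g ->
  lie_deriv X (fun x => f x - g x) p = lie_deriv X f p - lie_deriv X g p.
Proof. exact: dfunB. Qed.

Lemma lie_derivD O X f g p : O p -> smooth_fun O f -> smooth_fun O g ->
  lie_deriv X (fun x => f x + g x) p = lie_deriv X f p + lie_deriv X g p.
Proof. exact: dfunD. Qed.

Lemma lie_deriv_cst O X f c p : open O -> O p -> (forall q, O q -> f q = c) ->
  lie_deriv X f p = 0.
Proof.
move=> oO Op fc; rewrite (lie_deriv_eq X (g := fun=> c) oO) //.
exact: dfun_cst.
Qed.

#[local] Opaque lie_deriv bracket.

(** Tested on a coordinate function, the three double brackets expand into twelve triple derivatives
    that cancel in pairs. *)
Lemma jacobi O X Y Z p : open O -> smooth_vf O X -> smooth_vf O Y ->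
  smooth_vf O Z -> O p ->
  bracket (bracket X Y) Z p + bracket (bracket Y Z) X p + bracket (bracket Z X) Y p = 0.
Proof.
move=> oO sX sY sZ Op; pose U := dom M p `&` O.
have oU : open U by apply: openI => //; exact: dom_open.
have Up : U p by split=> //; exact: dom_self.
have sub : U `<=` O by move=> x [].
have {}sX := smooth_vf_sub sub sX; have {}sY := smooth_vf_sub sub sY.
have {}sZ := smooth_vf_sub sub sZ.
have addE (a b : 'rV[R]_m) j : (a + b) 0 j = a 0 j + b 0 j by rewrite mxE.
have zE j : (0 : 'rV[R]_m) 0 j = 0 by rewrite mxE.
apply/rowP => j; apply: etrans (esym (zE j)).
apply: (etrans (addE _ _ _)); apply: (etrans (f_equal2 +%R (addE _ _ _) erefl)).
apply: (etrans (f_equal2 +%R (f_equal2 +%R (bracketE _ _ _ _) (bracketE _ _ _ _))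
  (bracketE _ _ _ _))).
set c := coord p j.
have sc : smooth_fun U c by apply: smooth_fun_sub (@smooth_coord p j) => x [].
have E A B C : smooth_vf U A -> smooth_vf U B -> smooth_vf U C ->
    lie_deriv (bracket A B) (lie_deriv C c) p - lie_deriv C (lie_deriv (bracket A B) c) p
    = lie_deriv A (lie_deriv B (lie_deriv C c)) p - lie_deriv B (lie_deriv A (lie_deriv C c)) p
    - (lie_deriv C (lie_deriv A (lie_deriv B c)) p - lie_deriv C (lie_deriv B (lie_deriv A c)) p).
  move=> sA sB sC; have L := smooth_lie_deriv oU.
  have L2 A' B' (sA' : smooth_vf U A') (sB' : smooth_vf U B') :=
    L _ _ sA' (L _ _ sB' sc).
  rewrite (lie_deriv_bracket oU sA sB (L _ _ sC sc) Up).
  congr (_ - _); rewrite -(lie_derivB C oU Up (L2 _ _ sA sB) (L2 _ _ sB sA)).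
  by apply: (lie_deriv_eq _ oU) => // q Uq; exact: (lie_deriv_bracket oU).
apply: (etrans (f_equal2 +%R (f_equal2 +%R (E _ _ _ sX sY sZ) (E _ _ _ sY sZ sX))
  (E _ _ _ sZ sX sY))).
exact: alternating_sum0.
Qed.

End ManifoldCalculus.

Arguments open_chart {R m M O} p.

(** * Coordinate fields and smoothness of the complex structure *)

Section ConstantFields.
Context {R : realType} {m : nat} (M : manifold R m).
Implicit Types (O : set M) (f : M -> R) (X Y Z : vfield M) (p q : M).

(** The field with constant components [v] in [chart M p], converted at each [q] to the components
    in [chart M q]. It extends a vector at [p] to a local smooth field. *)
Definition chart_field p (v : 'rV[R]_m) : vfield M :=
  fun q => 'D_v (chart M q \o unchart M p) (chart M p q).

Lemma chart_field_self p v : chart_field p v p = v.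
Proof. exact: derive_chart_id. Qed.

Lemma lie_deriv_chart_field O p v f q : open O -> O q -> dom M p q ->
  smooth_fun O f ->
  lie_deriv (chart_field p v) f q = 'D_v (f \o unchart M p) (chart M p q).
Proof.
move=> oO Oq dq sf; pose t := chart M q \o unchart M p.
have tq : t (chart M p q) = chart M q q by rewrite /t /= chartK.
have dt : differentiable t (chart M p q).
  have [+ _] := @transition_smooth _ _ M p q 1; apply.
  by exists q => //; split=> //; exact: dom_self.
have df : differentiable (f \o unchart M q) (t (chart M p q)).
  by rewrite tq; apply: (smooth_fun_differentiable sf Oq); exact: dom_self.
transitivity ('D_v ((f \o unchart M q) \o t) (chart M p q)).
  rewrite (derive_comp _ dt df) /lie_deriv /chart_field -/t.
  by rewrite /dfun -tq.
apply: near_eq_derive; apply: (near_chart (dom_open q) (dom_self q) dq).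
by move=> q' dq' pq' /=; rewrite /t /= !chartK.
Qed.

Lemma smooth_chart_field p v : smooth_vf (dom M p) (chart_field p v).
Proof.
move=> O' f oO' OO' sf a k; have oc := open_chart a oO'.
pose t := chart M p \o unchart M a.
pose h := fun x => 'D_v (f \o unchart M p) x.
have C : Ck k (chart M a @` (dom M a `&` O')) (h \o t).
  apply: (@Ck_comp _ _ _ _ _ (chart M p @` (dom M p `&` O'))) => //.
  - move=> _ [q [dq Oq] <-]; exists q; first by split=> //; exact: OO'.
    by rewrite /t /= chartK.
  - apply: Ck_sub (@transition_smooth _ _ M a p k) => _ [q [dq Oq] <-].
    by exists q => //; split=> //; exact: OO'.
  - by have [_] := sf p k.+1; apply.
apply: (Ck_eq oc) C => _ [q [dq Oq] <-].
by rewrite /h /t /= chartK // (lie_deriv_chart_field _ oO' Oq (OO' _ Oq) sf).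
Qed.

End ConstantFields.

Section ComplexStructure.
Context {R : realType} {N : nat} (M : complex_manifold R N).

(** [J0] commutes with the Jacobians of the holomorphic transitions, so in any one chart the
    components of J X are constant combinations of those of [X]. *)
Lemma smooth_act_J (O : set M) (X : vfield M) : open O -> smooth_vf O X ->
  smooth_vf O (act (Jtensor M) X).
Proof.
move=> oO sX; apply: smooth_vf_chart => // p j k.
have oc := open_chart p oO.
have E q : dom M p q -> O q -> lie_deriv (act (Jtensor M) X) (coord p j) q
    = \sum_l lie_deriv X (coord p l) q * @J0 R N l j.
  move=> dq Oq; pose t := chart M p \o unchart M q.
  have qin : (chart M q @` (dom M q `&` dom M p)) (chart M q q).
    by exists q => //; split=> //; exact: dom_self.
  have dt : differentiable t (chart M q q).
    by have [+ _] := @transition_smooth _ _ M q p 1; apply.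
  have dfunE v i : dfun (coord p i) q v = (v *m jacobian t (chart M q q)) 0 i.
    rewrite -deriveEjacobian // -derive_coord //; exact: diff_derivable.
  rewrite /lie_deriv dfunE /act -mulmxA (transition_holomorphic qin) mulmxA mxE.
  by apply: eq_bigr => l _; rewrite dfunE.
have C l : Ck k (chart M p @` (dom M p `&` O))
    (fun x => (lie_deriv X (coord p l) \o unchart M p) x * @J0 R N l j).
  apply: CkM => //; last exact: Ck_cst.
  have := @smooth_lie_deriv_coord _ _ _ O X p l oO sX p k.
  by rewrite setIA setIid.
apply: (Ck_eq oc _ (Ck_sum oc C)) => _ [q [dq Oq] <-] /=.
by rewrite chartK // E.
Qed.

End ComplexStructure.

(** * Brackets of fields tangent to a submanifold *)

Section Limits.
Context {R : realType} {T : Type} (F : set_system T) {FF : Filter F}.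

Lemma cvg_prod (I : Type) (r : seq I) (f : I -> T -> R) (a : I -> R) :
  (forall i, f i x @[x --> F] --> a i) ->
  \prod_(i <- r) f i x @[x --> F] --> \prod_(i <- r) a i.
Proof.
move=> fa; elim: r => [|i r IH].
  by rewrite big_nil; under eq_cvg do rewrite big_nil; exact: cvg_cst.
by rewrite big_cons; under eq_cvg do rewrite big_cons; exact: cvgM.
Qed.

Lemma cvg_sumr (I : Type) (r : seq I) (f : I -> T -> R) (a : I -> R) :
  (forall i, f i x @[x --> F] --> a i) ->
  \sum_(i <- r) f i x @[x --> F] --> \sum_(i <- r) a i.
Proof.
move=> fa; elim: r => [|i r IH].
  by rewrite big_nil; under eq_cvg do rewrite big_nil; exact: cvg_cst.
by rewrite big_cons; under eq_cvg do rewrite big_cons; exact: cvgD.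
Qed.

Lemma cvg_det n (A : T -> 'M[R]_n) (A0 : 'M[R]_n) :
  (forall i j, A x i j @[x --> F] --> A0 i j) ->
  \det (A x) @[x --> F] --> \det A0.
Proof.
move=> cA; apply: cvg_sumr => s; apply: cvgM; first exact: cvg_cst.
by apply: cvg_prod => i; exact: cA.
Qed.

(** Near the limit the determinant is nonzero, and there [invmx] is the adjugate divided by the
    determinant. *)
Lemma cvg_invmx n (A : T -> 'M[R]_n) (A0 : 'M[R]_n) i j :
  A0 \in unitmx ->
  (forall i j, A x i j @[x --> F] --> A0 i j) ->
  (invmx (A x)) i j @[x --> F] --> (invmx A0) i j.
Proof.
move=> uA0 cA; have cdet := cvg_det cA.
have d0 : \det A0 != 0 by rewrite -unitfE -unitmxE.
have ndet : \forall x \near F, \det (A x) != 0.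
  by apply: (cvgr_neq0 _ cdet).
have E (B : 'M[R]_n) : \det B != 0 -> (invmx B) i j = (\det B)^-1 * cofactor B j i.
  move=> dB; have uB : B \in unitmx by rewrite unitmxE unitfE.
  by rewrite /invmx uB !mxE.
rewrite E //; apply: (@cvg_trans _ ((\det (A x))^-1 * cofactor (A x) j i @[x --> F])).
  by apply: near_eq_cvg; apply: filterS ndet => x dx; rewrite E.
apply: cvgM; first exact: cvgV.
apply: cvgM; first exact: cvg_cst.
apply: cvg_det => a b; rewrite !mxE.
by under eq_cvg do rewrite !mxE; exact: cA.
Qed.

(* Near the limit [Y = G *m invmx A], so [Y] converges although nothing is
   assumed about it beyond the linear system it solves. *)
Lemma cvg_linear_system n (A : T -> 'M[R]_n) (Y : T -> 'rV[R]_n)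
    (A0 : 'M[R]_n) (Y0 : 'rV[R]_n) i :
  A0 \in unitmx ->
  (forall i j, A x i j @[x --> F] --> A0 i j) ->
  (forall j, (Y x *m A x) 0 j @[x --> F] --> (Y0 *m A0) 0 j) ->
  Y x 0 i @[x --> F] --> Y0 0 i.
Proof.
move=> uA0 cA cYA; have cdet := cvg_det cA.
have d0 : \det A0 != 0 by rewrite -unitfE -unitmxE.
have ndet : \forall x \near F, \det (A x) != 0.
  by apply: (cvgr_neq0 _ cdet).
have E (B : 'M[R]_n) (y : 'rV[R]_n) : \det B != 0 ->
    y 0 i = \sum_j (y *m B) 0 j * (invmx B) j i.
  by move=> dB; rewrite -[in LHS](mulmxK (_ : B \in unitmx) y) ?mxE // unitmxE unitfE.
rewrite (E A0) //.
apply: (@cvg_trans _ ((\sum_j (Y x *m A x) 0 j * (invmx (A x)) j i) @[x --> F])).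
  by apply: near_eq_cvg; apply: filterS ndet => x dx; rewrite -E.
apply: cvg_sumr => j; apply: cvgM; first exact: cYA.
exact: cvg_invmx.
Qed.

End Limits.

Section VanishingFactor.
Context {R : realType} {V : normedModType R}.

(** Because [f x = 0], the difference quotient of the product is [c (h *: v + x)] times that of [f],
    so continuity of [c] at [x] is enough. *)
Lemma is_derive_mul_vanishing (c f : V -> R) x v :
  f x = 0 -> derivable f x v -> {for x, continuous c} ->
  is_derive x v (fun y => c y * f y) (c x * 'D_v f x).
Proof.
move=> f0 df cc.
have lim : (fun h : R => h^-1 *: (((fun y => c y * f y) \o shift x) (h *: v)
    - (c x * f x))) @ 0^' --> c x * 'D_v f x.
  have -> : (fun h : R => h^-1 *: (((fun y => c y * f y) \o shift x) (h *: v)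
      - (c x * f x))) = (fun h => c (h *: v + x) * (h^-1 *: ((f \o shift x) (h *: v) - f x))).
    apply/funext => h /=; rewrite f0 mulr0 !subr0.
    by rewrite -[h^-1 *: _]/(_ * _) mulrCA.
  apply: cvgM; last exact: df.
  suff : {for 0, continuous (fun h : R => c (h *: v + x))}.
    by move=> /continuous_withinNx; rewrite scale0r add0r.
  apply: continuous_comp; last by rewrite scale0r add0r.
  apply: differentiable_continuous.
  exact: ex_diff.
apply: DeriveDef; first by apply/cvg_ex; eexists; exact: lim.
exact: cvg_lim lim.
Qed.

End VanishingFactor.

Lemma col_entry (R : Type) m n (A : 'M[R]_(m, n)) i j : col j A i 0 = A i j.
Proof. by rewrite mxE. Qed.

Section CoordinateCombinations.
Context {R : realType} {m : nat} (M : manifold R m).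
Implicit Types (O : set M) (p q : M).

Lemma smooth_fun_comb O n (f : 'I_n -> M -> R) (c : 'I_n -> R) : open O ->
  (forall i, smooth_fun O (f i)) -> smooth_fun O (fun x => \sum_(i < n) f i x * c i).
Proof.
move=> oO sf a l; have oc := open_chart a oO.
exact: (Ck_sum oc (fun j => CkM oc (sf j a l) (Ck_cst _ _ (c j)))).
Qed.

Lemma dfun_comb O n (f : 'I_n -> M -> R) (c : 'I_n -> R) p v : open O -> O p ->
  (forall i, smooth_fun O (f i)) ->
  dfun (fun x => \sum_(i < n) f i x * c i) p v = \sum_(i < n) dfun (f i) p v * c i.
Proof.
move=> oO Op; elim: n f c => [|n IH] f c sf.
  rewrite big_ord0 (dfun_eq (g := fun=> 0) _ oO Op); first exact: dfun_cst.
  by move=> q _; rewrite big_ord0.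
pose w := widen_ord (leqnSn n).
rewrite (dfun_eq (g := fun x => (\sum_(i < n) f (w i) x * c (w i))
   + f ord_max x * c ord_max) _ oO Op); last first.
  by move=> q _; rewrite big_ord_recr.
rewrite (dfunD _ Op (smooth_fun_comb _ oO (fun i => sf (w i)))); last first.
  by apply: smooth_funM => //; exact: smooth_fun_cst.
rewrite IH // big_ord_recr /= (dfunM _ Op (sf _) (smooth_fun_cst _ _)) dfun_cst.
by rewrite mulr0 add0r [c _ * _]mulrC.
Qed.

(** A function linear in the chart at [p], with differential [c] there. Covectors [c] that
    annihilate a subspace give functions testing membership in it. *)
Definition coord_comb p (c : 'cV[R]_m) : M -> R :=
  fun q => \sum_(j < m) coord p j q * c j 0.

Lemma smooth_coord_comb p c : smooth_fun (dom M p) (coord_comb p c).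
Proof. by apply: smooth_fun_comb (dom_open p) _ => j; exact: smooth_coord. Qed.

Lemma dfun_coord_comb p c v : dfun (coord_comb p c) p v = (v *m c) 0 0.
Proof.
rewrite (dfun_comb _ _ (dom_open p) (dom_self p)); last first.
  by move=> j; exact: smooth_coord.
by rewrite mxE; apply: eq_bigr => j _; rewrite dfun_coord.
Qed.

End CoordinateCombinations.

(** * Pullback of functions to the submanifold *)

Section Pullback.
Context {R : realType} {k m : nat} (M : manifold R k) (Mb : manifold R m).
Variables (iota : M -> Mb).
Hypothesis smooth_iota : smooth_map iota.
Implicit Types (O : set Mb) (f : Mb -> R) (p q : M) (X Y : vfield Mb).

Lemma open_preimage O : open O -> open (iota @^-1` O).
Proof. by move=> oO; case: smooth_iota => ci _; move/continuousP: ci; apply. Qed.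

Lemma differentiable_local_rep p : differentiable
  (chart Mb (iota p) \o iota \o unchart M p) (chart M p p).
Proof.
have [_ si] := smooth_iota; have [+ _] := si p (iota p) 1; apply.
by exists p => //; split; exact: dom_self.
Qed.

Lemma differentiable_pullback O f p : O (iota p) -> smooth_fun O f ->
  differentiable (f \o iota \o unchart M p) (chart M p p).
Proof.
move=> Op sf; set y := iota p.
pose t := chart Mb y \o iota \o unchart M p.
have dt : differentiable t (chart M p p) := differentiable_local_rep p.
have tp : t (chart M p p) = chart Mb y y.
  by rewrite /t /= chartK //; exact: dom_self.
have df : differentiable (f \o unchart Mb y) (t (chart M p p)).
  by rewrite tp; apply: (smooth_fun_differentiable sf Op); exact: dom_self.
apply: near_eq_differentiable (differentiable_comp dt df).
apply: (near_chart (open_preimage (dom_open y)) (dom_self y) (dom_self p)).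
by move=> q dq yq; rewrite /t /= chartK // chartK.
Qed.

Lemma dfun_pullback O f p v : open O -> O (iota p) -> smooth_fun O f ->
  dfun (f \o iota) p v = dfun f (iota p) (v *m dmap iota p).
Proof.
move=> oO Op sf; set y := iota p.
pose t := chart Mb y \o iota \o unchart M p.
have dt : differentiable t (chart M p p) := differentiable_local_rep p.
have tp : t (chart M p p) = chart Mb y y.
  by rewrite /t /= chartK //; exact: dom_self.
have df : differentiable (f \o unchart Mb y) (t (chart M p p)).
  by rewrite tp; apply: (smooth_fun_differentiable sf Op); exact: dom_self.
transitivity ('D_v ((f \o unchart Mb y) \o t) (chart M p p)).
  apply: near_eq_derive.
  apply: (near_chart (open_preimage (dom_open y)) (dom_self y) (dom_self p)).
  by move=> q dq yq; rewrite /t /= chartK // chartK.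
by rewrite (derive_comp _ dt df) (deriveEjacobian _ dt) tp.
Qed.

End Pullback.

Section TangentBracket.
Context {R : realType} {k m : nat} (M : manifold R k) (Mb : manifold R m).
Variables (iota : M -> Mb).
Hypothesis smooth_iota : smooth_map iota.
Implicit Types (O : set Mb) (p q : M) (X Y : vfield Mb).

Let fc p (c : 'cV[R]_m) : M -> R := coord_comb (iota p) c \o iota.

Let dfc p q c v : dom Mb (iota p) (iota q) ->
  dfun (fc p c) q v = dfun (coord_comb (iota p) c) (iota q) (v *m dmap iota q).
Proof.
by move=> dq; apply: (dfun_pullback smooth_iota _ (dom_open (iota p)) dq);
  exact: smooth_coord_comb.
Qed.

Let smooth_fc p c : smooth_fun (iota @^-1` dom Mb (iota p)) (fc p c).
Proof.
apply: (@smooth_fun_comb _ _ M _ _ (fun j q => coord (iota p) j (iota q))).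
  by apply: (open_preimage smooth_iota); exact: dom_open.
move=> j a l; have [_ si] := smooth_iota.
apply: (Ck_coord (f := chart Mb (iota p) \o iota \o unchart M a)); last exact: si.
by apply: open_chart; apply: (open_preimage smooth_iota); exact: dom_open.
Qed.

(* The components of a tangent field in a chart of the submanifold are only
   known to be continuous; this is enough because they multiply the partial
   derivatives of [fc p c], which vanish at p. *)
Lemma second_lie_deriv_tangent O (W : set M) X Y p c (xi eta : 'rV[R]_k) :
  open O -> open W -> W p -> smooth_vf O Y ->
  (forall q, W q -> O (iota q) /\ (Y (iota q) <= dmap iota q)%MS) ->
  row_free (dmap iota p) -> X (iota p) = xi *m dmap iota p ->
  Y (iota p) = eta *m dmap iota p -> dmap iota p *m c = 0 ->
  lie_deriv X (lie_deriv Y (coord_comb (iota p) c)) (iota p)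
  = 'D_eta (fun x => 'D_xi (fc p c \o unchart M p) x) (chart M p p).
Proof.
move=> oO oW Wp sY tY free Xp Yp dc.
have Op : O (iota p) by case: (tY _ Wp).
pose U := iota @^-1` dom Mb (iota p).
have oU : open U by apply: (open_preimage smooth_iota); exact: dom_open.
have Up : U p by exact: dom_self.
have oWU : open (W `&` U) by exact: openI.
have oI : open (O `&` dom Mb (iota p)) by apply: openI => //; exact: dom_open.
have sYc b : smooth_fun (O `&` dom Mb (iota p)) (lie_deriv Y (coord_comb (iota p) b)).
  apply: smooth_lie_deriv => //; first by apply: smooth_vf_sub sY => x [].
  by apply: smooth_fun_sub (@smooth_coord_comb _ _ _ (iota p) b) => x [].
set x0 := chart M p p.
pose eta_ q : 'rV[R]_k := Y (iota q) *m pinvmx (dmap iota q).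
have eta_p : eta_ p = eta by rewrite /eta_ Yp mulmxKp.
have Yeta q : W q -> Y (iota q) = eta_ q *m dmap iota q.
  by move=> Wq; exact: (esym (mulmxKpV (tY q Wq).2)).
(* [eta_ q] is written in the chart of [q], which may jump with [q]; [Yh] holds the same components
   in the single chart around [p]. *)
pose Yh (x : 'rV[R]_k) : 'rV[R]_k :=
  \row_i dfun (coord p i) (unchart M p x) (eta_ (unchart M p x)).
pose d b i x := 'D_(delta_mx 0 i) (fc p b \o unchart M p) x.
have Efc b q : dom M p q -> W q -> U q ->
    lie_deriv Y (coord_comb (iota p) b) (iota q)
    = \sum_(i < k) Yh (chart M p q) 0 i * d b i (chart M p q).
  move=> dq Wq Uq.
  have Yhq i : Yh (chart M p q) 0 i = dfun (coord p i) q (eta_ q).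
    by rewrite mxE chartK.
  apply: (etrans (f_equal (dfun _ _) (Yeta _ Wq))).
  apply: (etrans (esym (dfc b (eta_ q) Uq))).
  apply: (etrans (dfun_chart (eta_ q) oU Uq dq (smooth_fc p b))).
  by apply: eq_bigr => i _; rewrite Yhq.
have dd b i : differentiable (d b i) x0.
  have [_ /(_ (delta_mx 0 i)) [+ _]] := smooth_fc p b p 2; apply.
  by exists p => //; split=> //; exact: dom_self.
have d0 b i : d b i x0 = (dmap iota p *m b) i 0.
  have -> : d b i x0 = dfun (fc p b) p (delta_mx 0 i) by [].
  by rewrite dfc // dfun_coord_comb -rowE -row_mul mxE.
have Yh0 : Yh x0 = eta.
  apply/rowP => i; rewrite mxE /x0 chartK; last exact: dom_self.
  by rewrite dfun_coord eta_p.
(* [B] is a right inverse of [dmap iota p], so the functions [fc p (col l B)] have at [p] the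
   differentials of the coordinates, and the matrix [A] of their partial derivatives is the identity
   at [x0]. The derivatives of the corresponding ambient functions along [Y], restricted to the
   submanifold, are continuous and equal [Yh *m A], so [Yh] solves a linear system with continuous
   data. *)
have cYh i : {for x0, continuous (fun x => Yh x 0 i)}.
  pose B := pinvmx (dmap iota p).
  pose A x : 'M[R]_k := \matrix_(i, l) d (col l B) i x.
  have A0 : A x0 = 1%:M.
    by apply/matrixP => a l; rewrite mxE d0 colE mulmxA mulmxVp // -colE mxE.
  have := @cvg_linear_system _ _ (nbhs x0) _ k A Yh (A x0) (Yh x0) i.
  apply.
  - by rewrite A0 unitmx1.
  - move=> a l; rewrite mxE.
    under eq_cvg do rewrite mxE.
    exact: (differentiable_continuous (dd _ _)).
  - move=> l.
    pose gl := lie_deriv Y (coord_comb (iota p) (col l B)) \o iota \o unchart M p.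
    have Egl q : dom M p q -> (W `&` U) q ->
        gl (chart M p q) = (Yh (chart M p q) *m A (chart M p q)) 0 l.
      move=> dq [Wq Uq]; rewrite /gl /= chartK // Efc // [RHS]mxE.
      by apply: eq_bigr => a _; congr (_ * _); rewrite mxE.
    have pin : (W `&` U) p by [].
    rewrite -(Egl _ (dom_self p) pin).
    apply: (@cvg_trans _ (gl x @[x --> x0])).
      apply: near_eq_cvg; apply: (near_chart oWU pin (dom_self p)) => q dq Wq.
      exact: Egl.
    have pO : (O `&` dom Mb (iota p)) (iota p) by split=> //; exact: dom_self.
    exact/differentiable_continuous/(differentiable_pullback smooth_iota pO (sYc _)).
pose gc := lie_deriv Y (coord_comb (iota p) c).
have -> : lie_deriv X gc (iota p) = dfun (gc \o iota) p xi.
  apply: (etrans (f_equal (dfun _ _) Xp)).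
  have pin : (O `&` dom Mb (iota p)) (iota p) by split=> //; exact: dom_self.
  exact: (esym (dfun_pullback smooth_iota xi oI pin (sYc c))).
rewrite /dfun.
have der i : is_derive x0 xi (fun x => Yh x 0 i * d c i x) (Yh x0 0 i * 'D_xi (d c i) x0).
  apply: is_derive_mul_vanishing => //; first by rewrite d0 dc mxE.
  exact: diff_derivable.
transitivity ('D_xi (\sum_(i < k) (fun x => Yh x 0 i * d c i x)) x0).
  apply: near_eq_derive.
  have pin : (W `&` U) p by [].
  apply: (near_chart oWU pin (dom_self p)) => q dq [Wq Uq] /=.
  by rewrite chartK // /gc (Efc _ _ dq Wq Uq) fct_sumE.
rewrite derive_val Yh0.
have xin : (chart M p @` (dom M p `&` U)) x0.
  by exists p => //; split=> //; exact: dom_self.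
rewrite [RHS]derive_rV.
  apply: eq_bigr => i _; apply: (f_equal2 *%R (erefl (eta 0 i))).
  exact: (derive_swap _ _ (open_chart p oU) xin (smooth_fc p c p 2)).
by have [_ /(_ xi) [+ _]] := smooth_fc p c p 2; apply.
Qed.

(** The columns of [cokermx] are covectors annihilating the tangent space. For the function attached
    to such a column, the two iterated derivatives are one Hessian with its arguments in either
    order, so the bracket kills the function. *)
Lemma bracket_tangent O (W : set M) X Y p :
  open O -> open W -> W p -> smooth_vf O X -> smooth_vf O Y ->
  (forall q, W q -> [/\ O (iota q), (X (iota q) <= dmap iota q)%MS &
                       (Y (iota q) <= dmap iota q)%MS]) ->
  row_free (dmap iota p) ->
  (bracket X Y (iota p) <= dmap iota p)%MS.
Proof.
move=> oO oW Wp sX sY tXY free.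
have [Op /mulmxKpV Xp /mulmxKpV Yp] := tXY _ Wp.
rewrite submxE; apply/eqP/rowP => j; rewrite [RHS]mxE.
set c := col j (cokermx (dmap iota p)).
have dc : dmap iota p *m c = 0 by rewrite /c colE mulmxA mulmx_coker mul0mx.
have -> : (bracket X Y (iota p) *m cokermx (dmap iota p)) 0 j
    = dfun (coord_comb (iota p) c) (iota p) (bracket X Y (iota p)).
  rewrite dfun_coord_comb.
  have -> : bracket X Y (iota p) *m c = col j (bracket X Y (iota p) *m cokermx (dmap iota p)).
    by rewrite /c !colE mulmxA.
  exact: (esym (col_entry _ _ _)).
have oI : open (O `&` dom Mb (iota p)) by apply: openI => //; exact: dom_open.
have pin : (O `&` dom Mb (iota p)) (iota p) by split=> //; exact: dom_self.
have sX' : smooth_vf (O `&` dom Mb (iota p)) X by apply: smooth_vf_sub sX => x [].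
have sY' : smooth_vf (O `&` dom Mb (iota p)) Y by apply: smooth_vf_sub sY => x [].
have sc : smooth_fun (O `&` dom Mb (iota p)) (coord_comb (iota p) c).
  by apply: smooth_fun_sub (@smooth_coord_comb _ _ _ (iota p) c) => x [].
have tX q : W q -> O (iota q) /\ (X (iota q) <= dmap iota q)%MS by move=> /tXY [].
have tY q : W q -> O (iota q) /\ (Y (iota q) <= dmap iota q)%MS by move=> /tXY [].
apply: (etrans (lie_deriv_bracket oI sX' sY' sc pin)).
have E1 := second_lie_deriv_tangent oO oW Wp sY tY free (esym Xp) (esym Yp) dc.
have E2 := second_lie_deriv_tangent oO oW Wp sX tX free (esym Yp) (esym Xp) dc.
apply: (etrans (f_equal2 (fun a b => a - b) E1 E2)); apply/eqP; rewrite subr_eq0.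
apply/eqP.
pose U := iota @^-1` dom Mb (iota p).
have oU : open U by apply: (open_preimage smooth_iota); exact: dom_open.
have Up : U p by exact: dom_self.
have xin : (chart M p @` (dom M p `&` U)) (chart M p p).
  exact (ex_intro2 _ _ p (conj (dom_self p) Up) erefl).
exact: (derive_swap _ _ (open_chart p oU) xin (smooth_fc p c p 2)).
Qed.

End TangentBracket.

(** * The Levi-Civita connection *)

#[local] Opaque lie_deriv bracket.

Lemma closed_form_sum (R : comPzRingType) (a b c d e f x y z j1 j2 j3 : R) :
  j1 + j2 + j3 = 0 ->
  a - b - x - j1 + (c - d - y - j2) + (e - f - z - j3)
  = a - f - y + (c - b - z) + (e - d - x).
Proof. by move=> J; rewrite -[RHS]subr0 -J; ring. Qed.

Section MetricConnection.
Context {R : realType} {m : nat} (M : manifold R m).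
Variables (g : M -> 'M[R]_m) (D : vfield M -> vfield M -> vfield M).
Hypotheses (hg : semi_riemannian g) (hD : levi_civita g D).
Implicit Types (O : set M) (f : M -> R) (W X Y Z : vfield M) (p q : M).

Lemma gdotC p v w : gdot g p v w = gdot g p w v.
Proof.
rewrite /gdot -[RHS]trace_mx11 -[LHS]trace_mx11 -mxtrace_tr.
by rewrite !trmx_mul trmxK (metric_sym hg) mulmxA.
Qed.

Lemma gdotDl p v v' w : gdot g p (v + v') w = gdot g p v w + gdot g p v' w.
Proof. by rewrite /gdot !mulmxDl mxE. Qed.

Lemma gdotZl p a v w : gdot g p (a *: v) w = a * gdot g p v w.
Proof. by rewrite /gdot -!scalemxAl mxE. Qed.

Lemma gdotNl p v w : gdot g p (- v) w = - gdot g p v w.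
Proof. by rewrite -scaleN1r gdotZl mulN1r. Qed.

Lemma gdotBl p v v' w : gdot g p (v - v') w = gdot g p v w - gdot g p v' w.
Proof. by rewrite gdotDl gdotNl. Qed.

Lemma gdot0l p w : gdot g p 0 w = 0.
Proof. by rewrite -(scale0r w) gdotZl mul0r. Qed.

Lemma gdotDr p v w w' : gdot g p v (w + w') = gdot g p v w + gdot g p v w'.
Proof. by rewrite gdotC gdotDl !(gdotC _ v). Qed.

Lemma gdotZr p a v w : gdot g p v (a *: w) = a * gdot g p v w.
Proof. by rewrite gdotC gdotZl (gdotC _ v). Qed.

Lemma gdotNr p v w : gdot g p v (- w) = - gdot g p v w.
Proof. by rewrite gdotC gdotNl (gdotC _ v). Qed.

Lemma gdotBr p v w w' : gdot g p v (w - w') = gdot g p v w - gdot g p v w'.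
Proof. by rewrite gdotDr gdotNr. Qed.

Lemma gdot0r p v : gdot g p v 0 = 0.
Proof. by rewrite gdotC gdot0l. Qed.

(* Off O the field [Z] is multiplied by 1 and on O by 0, so the multiple is [Z]
   itself when [Z] vanishes on O. *)
Let mask O (x : M) : R := if `[< O x >] then 0 else 1.

Let smooth_mask O : open O -> smooth_fun O (mask O).
Proof.
move=> oO; apply: smooth_fun_eq (smooth_fun_cst O 0) => // p Op.
by rewrite /mask asboolT.
Qed.

Let mask_vanishing O Z : (forall q, O q -> Z q = 0) ->
  (fun x => mask O x *: Z x) = Z.
Proof.
move=> Z0; apply/funext => x; rewrite /mask; case: asboolP => [Ox|_].
  by rewrite scale0r Z0.
by rewrite scale1r.
Qed.

Let mask0 O p : O p -> mask O p = 0.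
Proof. by move=> Op; rewrite /mask asboolT. Qed.

(** Locality is not an axiom of [levi_civita]. It follows from linearity over functions, since the
    multiplier [mask O] is constant on [O] and hence smooth there. *)
Lemma nabla_vanishingl O Z Y p : open O -> smooth_vf O Z -> smooth_vf O Y ->
  (forall q, O q -> Z q = 0) -> O p -> D Z Y p = 0.
Proof.
move=> oO sZ sY Z0 Op; rewrite -(mask_vanishing Z0).
by rewrite (nabla_scalel hD oO (smooth_mask oO) sZ sY Op) mask0 // scale0r.
Qed.

Lemma nabla_vanishingr O X Z p : open O -> smooth_vf O X -> smooth_vf O Z ->
  (forall q, O q -> Z q = 0) -> O p -> D X Z p = 0.
Proof.
move=> oO sX sZ Z0 Op; rewrite -(mask_vanishing Z0).
rewrite (nabla_leibniz hD oO (smooth_mask oO) sX sZ Op) mask0 // scale0r Z0 //.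
by rewrite scaler0 addr0.
Qed.

Let addfBK X X' : (fun x => X x + (X' x - X x)) = X'.
Proof. by apply/funext => x; rewrite addrC subrK. Qed.

Let smooth_sub O X X' : smooth_vf O X -> smooth_vf O X' ->
  smooth_vf O (fun x => X' x - X x).
Proof. by move=> sX sX'; exact: (smooth_vfD sX' (smooth_vfN sX)). Qed.

Lemma nabla_eql O X X' Y p : open O -> smooth_vf O X -> smooth_vf O X' ->
  smooth_vf O Y -> (forall q, O q -> X q = X' q) -> O p -> D X Y p = D X' Y p.
Proof.
move=> oO sX sX' sY XX' Op; have sZ := smooth_sub sX sX'.
rewrite -[in RHS](addfBK X X') (nabla_addl hD oO sX sZ sY Op).
rewrite (nabla_vanishingl oO sZ sY _ Op) ?addr0 // => q Oq.
by rewrite XX' // subrr.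
Qed.

Lemma nabla_oppl O X Y p : open O -> smooth_vf O X -> smooth_vf O Y -> O p ->
  D (fun x => - X x) Y p = - D X Y p.
Proof.
move=> oO sX sY Op; rewrite -scaleN1r.
rewrite -(nabla_scalel hD oO (smooth_fun_cst O (-1)) sX sY Op).
by congr (D _ Y p); apply/funext => x; rewrite scaleN1r.
Qed.

Lemma bracketC X Y p : bracket Y X p = - bracket X Y p.
Proof. by apply/rowP => j; rewrite !mxE opprB. Qed.

Lemma bracket_vanishingl O X Y p : open O -> smooth_vf O X -> smooth_vf O Y ->
  (forall q, O q -> X q = 0) -> O p -> bracket X Y p = 0.
Proof.
move=> oO sX sY X0 Op; rewrite -(nabla_torsion_free hD oO sX sY Op).
by rewrite (nabla_vanishingl oO sX) // (nabla_vanishingr oO sY sX) // subrr.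
Qed.

Definition inner X Y : M -> R := fun p => gdot g p (X p) (Y p).

(* Twice the exterior derivative of the 1-form dual to [W], in the convention of
   [ext_deriv]. *)
Definition dform W X Y : M -> R :=
  fun p => gdot g p (D X W p) (Y p) - gdot g p (D Y W p) (X p).

Lemma smooth_inner O X Y : open O -> smooth_vf O X -> smooth_vf O Y ->
  smooth_fun O (inner X Y).
Proof. exact: metric_smooth. Qed.

Lemma lie_inner O X Y Z p : open O -> smooth_vf O X -> smooth_vf O Y ->
  smooth_vf O Z -> O p ->
  lie_deriv X (inner Y Z) p = gdot g p (D X Y p) (Z p) + gdot g p (Y p) (D X Z p).
Proof. exact: nabla_metric. Qed.

Lemma dformE O W X Y p : open O -> smooth_vf O W -> smooth_vf O X ->
  smooth_vf O Y -> O p ->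
  dform W X Y p = lie_deriv X (inner W Y) p - lie_deriv Y (inner W X) p
                  - gdot g p (W p) (bracket X Y p).
Proof.
move=> oO sW sX sY Op; rewrite (lie_inner oO sX sW sY Op) (lie_inner oO sY sW sX Op).
rewrite -(nabla_torsion_free hD oO sX sY Op) gdotBr /dform.
move: (gdot g p _ _) (gdot g p _ _) (gdot g p _ _) (gdot g p _ _) => a b c d.
ring.
Qed.

(** The second exterior derivative of the form dual to [W] is 0: the second derivatives of inner
    products cancel, and what remains is the Jacobi identity paired with [W]. *)
Lemma dform_closed O W X Y Z p : open O -> smooth_vf O W -> smooth_vf O X ->
  smooth_vf O Y -> smooth_vf O Z -> O p ->
  lie_deriv X (dform W Y Z) p + lie_deriv Y (dform W Z X) p
  + lie_deriv Z (dform W X Y) p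
  = dform W (bracket X Y) Z p + dform W (bracket Y Z) X p + dform W (bracket Z X) Y p.
Proof.
move=> oO sW sX sY sZ Op.
have L A B (sA : smooth_vf O A) (sB : smooth_vf O B) :=
  smooth_lie_deriv oO sA (smooth_inner oO sW sB).
have E1 A B C : smooth_vf O A -> smooth_vf O B -> smooth_vf O C ->
    lie_deriv A (dform W B C) p
    = lie_deriv A (lie_deriv B (inner W C)) p - lie_deriv A (lie_deriv C (inner W B)) p
      - lie_deriv A (inner W (bracket B C)) p.
  move=> sA sB sC; have sBC := smooth_inner oO sW (smooth_bracket sB sC).
  rewrite -(lie_derivB A oO Op (L _ _ sB sC) (L _ _ sC sB)).
  rewrite -(lie_derivB A oO Op (smooth_funB oO (L _ _ sB sC) (L _ _ sC sB)) sBC).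
  by apply: (lie_deriv_eq _ oO) => // q Oq; exact: (dformE oO).
have E2 A B C : smooth_vf O A -> smooth_vf O B -> smooth_vf O C ->
    dform W (bracket A B) C p
    = lie_deriv A (lie_deriv B (inner W C)) p - lie_deriv B (lie_deriv A (inner W C)) p
      - lie_deriv C (inner W (bracket A B)) p - gdot g p (W p) (bracket (bracket A B) C p).
  move=> sA sB sC; have sAB := smooth_bracket sA sB.
  by rewrite (dformE oO sW sAB sC Op)
    (lie_deriv_bracket oO sA sB (smooth_inner oO sW sC) Op).
have J := f_equal (gdot g p (W p)) (jacobi oO sX sY sZ Op).
rewrite !gdotDr gdot0r in J.
apply: (etrans (f_equal2 +%R (f_equal2 +%R (E1 _ _ _ sX sY sZ) (E1 _ _ _ sY sZ sX))
  (E1 _ _ _ sZ sX sY))).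
apply: esym.
apply: (etrans (f_equal2 +%R (f_equal2 +%R (E2 _ _ _ sX sY sZ) (E2 _ _ _ sY sZ sX))
  (E2 _ _ _ sZ sX sY))).
exact: (closed_form_sum _ _ _ _ _ _ _ _ _ J).
Qed.

End MetricConnection.

(** * Normal contact metric structures *)

#[local] Opaque lie_deriv bracket gdot.

(** * Algebraic identities used with half of the normality conditions *)

Lemma nijenhuis_split (V : zmodType) (a b c d w : V) :
  a = 0 -> c = 0 -> a + b - c - d = - w -> d - b = w.
Proof. by move=> -> ->; rewrite add0r subr0 => E; rewrite -[w]opprK -E opprB. Qed.

Lemma eval_du (R : comPzRingType) (d A s1 s2 B C b c : R) :
  d = 2 * A + (s1 * B - s2 * C) -> B = b -> C = c -> d = 2 * A + (s1 * b - s2 * c).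
Proof. by move=> -> -> ->. Qed.

Lemma killing_scalar (R : realFieldType)
    (L1 L2 L3 d1 d2 d3 a b a' b' b1 c1 c2 c3 c3' su sx sy s1 s2 s3 t t' : R) :
  L1 + L2 + L3 = d1 + d2 + d3 ->
  L1 = 2 * (a + b) -> L2 = 0 -> L3 = 0 ->
  d1 = 2 * c1 + (s1 * 0 - sy * - sx) ->
  d2 = 2 * c2 + (s2 * 0 - su * (- 2 * t)) ->
  d3 = 2 * c3 + (s3 * 0 - sx * sy) ->
  c2 = 0 -> c3 = - c3' -> a = c1 + a' -> b = b1 + b' -> t' = t ->
  b1 + c3' = su * t' -> a' + b' = 0.
Proof. move=> + L1E L2E L3E d1E d2E d3E c2E c3E aE bE tE e; subst; lra. Qed.

Lemma half_antisymmetric (R : realFieldType) (a b t s1 s2 : R) :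
  a + b = 0 -> a - b = 2 * t + (s1 * 0 - s2 * 0) -> a = t.
Proof. lra. Qed.

Lemma nablaG_skew_scalar (R : realFieldType) (l a1 a2 a3 a4 b2 b4 : R) :
  l = a1 + a2 + (a3 + a4) -> l = 0 -> a2 = b2 -> a4 = b4 ->
  a1 + a3 = - (b4 + b2).
Proof. move=> *; subst; lra. Qed.

Lemma cyclic_term_scalar (R : realFieldType)
    (l d br rAB a2 h1 rBA a1 rAC sA sC hBC hAB : R) :
  l = 2 * (rAB + a2) -> d = 2 * br + 2 * sC * hAB -> br = rAB - rBA ->
  a1 + rAB = - (a2 + rAC) -> h1 = - hBC ->
  l - d = 2 * (- (a1 + rAB - sA * h1) + sA * hBC - sC * hAB - rAC + rBA).
Proof. by move=> -> -> -> e ->; rewrite e; ring. Qed.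

Lemma cyclic_sum_scalar (R : realFieldType)
    (l1 l2 l3 d1 d2 d3 e1 e2 e3 t1 t2 t3 r1 r2 r3 : R) :
  l1 + l2 + l3 = d1 + d2 + d3 ->
  l1 - d1 = 2 * (- e1 + t1 - t3 - r1 + r2) ->
  l2 - d2 = 2 * (- e2 + t2 - t1 - r2 + r3) ->
  l3 - d3 = 2 * (- e3 + t3 - t2 - r3 + r1) -> e1 + e2 + e3 = 0.
Proof. lra. Qed.

Lemma nijenhuis_scalar (R : comPzRingType)
    (x1 x2 x3 x4 y4 p1 q1 p2 q2 p3 q3 p5 q5 : R) :
  x1 = p1 - q1 -> x2 = - (p2 - q2) -> x3 = - (p3 - q3) -> x4 = - y4 ->
  y4 = - (p5 - q5) ->
  x1 + x4 - x2 - x3 = (p1 + p2) - (q1 + q3) + (p3 + p5) - (q2 + q5).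
Proof. by move=> -> -> -> -> ->; ring. Qed.

Lemma error_nijenhuis_scalar (R : comPzRingType)
    (c1 c2 c3 c4 sGY sGZ sY sZ hY hZ g1 g2 k1 k2 x y : R) :
  c1 - c2 + c3 - c4 = - sGZ * hY + sGY * hZ - sY * g1 + sZ * g2 ->
  (c3 - sY * k1) + x + y = 0 -> x = - (c4 - sZ * k2) -> g2 = - k2 -> g1 = - k1 ->
  (c1 - sGY * hZ) - (c2 - sGZ * hY) = y.
Proof.
move=> E1 E2 E3 E4 E5; apply/eqP; rewrite -subr_eq0; apply/eqP.
rewrite -[RHS](subrr (c1 - c2 + c3 - c4)) [in X in _ = _ - X]E1 E4 E5.
by rewrite -[LHS]addr0 -E2 E3; ring.
Qed.

Lemma polarization0 (R : realFieldType) (x x' y y' z : R) :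
  z - x' = y -> x - y' = z -> y = - y' -> x = - x' -> x = 0.
Proof. lra. Qed.

(** * Covariant derivatives of U and G from half of the normality conditions *)

Section HalfNormal.
Context {R : realType} {m : nat} (M : manifold R m).
Variables (g : M -> 'M[R]_m) (D : vfield M -> vfield M -> vfield M).
Hypotheses (hg : semi_riemannian g) (hD : levi_civita g D).
Implicit Types (O : set M) (W X Y Z : vfield M) (p q : M).

Definition horizontal_field O (U V : vfield M) X : Prop :=
  smooth_vf O X /\
  forall q, O q -> gdot g q (U q) (X q) = 0 /\ gdot g q (V q) (X q) = 0.

(* The half of the normality conditions that involves [nijenhuis G].  Exchanging
   (U, G) with (V, H) and replacing s by - s gives the other half. *)
Record half_normal O (U V : vfield M) (G H : tensor11 M)
    (s : vfield M -> M -> R) : Prop := HalfNormal {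
  hn_open : open O;
  hn_smoothU : smooth_vf O U;
  hn_smoothV : smooth_vf O V;
  hn_smoothG : forall X, smooth_vf O X -> smooth_vf O (act G X);
  hn_smoothH : forall X, smooth_vf O X -> smooth_vf O (act H X);
  hn_UU : forall q, O q -> gdot g q (U q) (U q) = 1;
  hn_VV : forall q, O q -> gdot g q (V q) (V q) = 1;
  hn_UV : forall q, O q -> gdot g q (U q) (V q) = 0;
  hn_skewG : forall X Y q, O q ->
    gdot g q (act G X q) (Y q) = - gdot g q (X q) (act G Y q);
  hn_skewH : forall X Y q, O q ->
    gdot g q (act H X q) (Y q) = - gdot g q (X q) (act H Y q);
  hn_GU : forall q, O q -> act G U q = 0;
  hn_GV : forall q, O q -> act G V q = 0;
  hn_HU : forall q, O q -> act H U q = 0;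
  hn_HV : forall q, O q -> act H V q = 0;
  hn_GG : forall X q, O q -> gdot g q (U q) (X q) = 0 -> gdot g q (V q) (X q) = 0 ->
    act G (act G X) q = - X q;
  hn_HG : forall X q, O q -> act H (act G X) q = - act G (act H X) q;
  hn_s : forall X q, smooth_vf O X -> O q -> s X q = gdot g q (D X U q) (V q);
  hn_du : forall X Y q, smooth_vf O X -> smooth_vf O Y -> O q ->
    dform g D U X Y q = 2 * gdot g q (X q) (act G Y q)
      + (s X q * gdot g q (V q) (Y q) - s Y q * gdot g q (V q) (X q));
  hn_dv : forall X Y q, smooth_vf O X -> smooth_vf O Y -> O q ->
    dform g D V X Y q = 2 * gdot g q (X q) (act H Y q)
      - (s X q * gdot g q (U q) (Y q) - s Y q * gdot g q (U q) (X q));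
  hn_nijU : forall X q, horizontal_field O U V X -> O q ->
    nijenhuis G U X q = - s U q *: act G (act H X) q;
  hn_nij : forall X Y Z q, horizontal_field O U V X -> horizontal_field O U V Y ->
    horizontal_field O U V Z -> O q ->
    gdot g q (nijenhuis G X Y q) (Z q)
    = - s (act G Y) q * gdot g q (act H X q) (Z q)
      + s (act G X) q * gdot g q (act H Y q) (Z q)
      - s X q * gdot g q (act G (act H Y) q) (Z q)
      + s Y q * gdot g q (act G (act H X) q) (Z q) }.

Variables (O : set M) (U V : vfield M) (G H : tensor11 M) (s : vfield M -> M -> R).
Hypothesis N : half_normal O U V G H s.

Let oO := hn_open N.
Let sU := hn_smoothU N.
Let sV := hn_smoothV N.
Local Notation hz := (horizontal_field O U V).

Lemma gdot_actG_U X q : O q -> gdot g q (U q) (act G X q) = 0.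
Proof.
move=> Oq; rewrite gdotC // (hn_skewG N) // (hn_GU N) //.
by rewrite gdot0r // oppr0.
Qed.

Lemma gdot_actG_V X q : O q -> gdot g q (V q) (act G X q) = 0.
Proof.
move=> Oq; rewrite gdotC // (hn_skewG N) // (hn_GV N) //.
by rewrite gdot0r // oppr0.
Qed.

Lemma gdot_actH_U X q : O q -> gdot g q (U q) (act H X q) = 0.
Proof.
move=> Oq; rewrite gdotC // (hn_skewH N) // (hn_HU N) //.
by rewrite gdot0r // oppr0.
Qed.

Lemma horizontal_actG X : smooth_vf O X -> hz (act G X).
Proof.
move=> sX; split; first exact: (hn_smoothG N).
by move=> q Oq; rewrite gdot_actG_U // gdot_actG_V.
Qed.

Lemma gdot_actG_actG X Y q : O q -> hz Y ->
  gdot g q (act G X q) (act G Y q) = gdot g q (X q) (Y q).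
Proof.
move=> Oq [_ hY]; have [uY vY] := hY q Oq.
by rewrite (hn_skewG N) // (hn_GG N) // gdotNr // opprK.
Qed.

Lemma dform_horizontal X Y q : hz X -> hz Y -> O q ->
  dform g D U X Y q = inner g X (act G Y) q + inner g X (act G Y) q.
Proof.
move=> [sX hX] [sY hY] Oq; rewrite (hn_du N) //.
have [_ vX] := hX q Oq; have [_ vY] := hY q Oq.
by rewrite vX vY /inner; ring.
Qed.

Lemma lie_dform_horizontal X Y Z p : smooth_vf O X -> hz Y -> hz Z -> O p ->
  lie_deriv X (dform g D U Y Z) p
  = 2 * (gdot g p (D X Y p) (act G Z p) + gdot g p (Y p) (D X (act G Z) p)).
Proof.
move=> sX hY hZ Op; have sY := hY.1; have sGZ := (horizontal_actG hZ.1).1.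
have sI := smooth_inner hg oO sY sGZ.
rewrite (lie_deriv_eq X oO (fun q => dform_horizontal hY hZ) Op).
rewrite (lie_derivD X Op sI sI) (lie_inner hD oO sX sY sGZ Op).
ring.
Qed.

(** The form dual to [V] vanishes on [X] and [Y], so its exterior derivative reduces to the bracket
    term, which [hn_dv] evaluates. *)
Lemma gdot_V_bracket X Y p : hz X -> hz Y -> O p ->
  gdot g p (V p) (bracket X Y p) = - 2 * gdot g p (X p) (act H Y p).
Proof.
move=> [sX hX] [sY hY] Op.
have := dformE hg hD oO sV sX sY Op.
rewrite (hn_dv N) // (hX p Op).1 (hY p Op).1.
rewrite (lie_deriv_cst X oO Op (fun q Oq => (hY q Oq).2)).
rewrite (lie_deriv_cst Y oO Op (fun q Oq => (hX q Oq).2)).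
lra.
Qed.

Lemma gdot_V_bracketU X p : hz X -> O p ->
  gdot g p (V p) (bracket U X p) = - s X p.
Proof.
move=> [sX hX] Op; have := dformE hg hD oO sV sU sX Op.
rewrite (hn_dv N) // (hX p Op).1 (hn_UU N) // gdot_actH_U //.
rewrite (lie_deriv_cst U oO Op (fun q Oq => (hX q Oq).2)).
rewrite (lie_deriv_cst X oO Op (f := inner g V U) (c := 0)); last first.
  by move=> q Oq; rewrite /inner gdotC // (hn_UV N).
lra.
Qed.

Lemma dform_bracket_horizontal X Y Z p : hz X -> hz Y -> hz Z -> O p ->
  dform g D U (bracket X Y) Z p
  = 2 * gdot g p (bracket X Y p) (act G Z p) + 2 * s Z p * gdot g p (X p) (act H Y p).
Proof.
move=> hX hY hZ Op; have sXY := smooth_bracket hX.1 hY.1.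
rewrite (hn_du N sXY hZ.1 Op) (hZ.2 p Op).2 gdot_V_bracket //.
ring.
Qed.

(** [act G U] vanishes on [O], so two of the four Nijenhuis terms drop; the other two measure how
    far the bracket with [U] is from commuting with [G]. *)
Lemma nijenhuisU X p : hz X -> O p ->
  act G (bracket U (act G X)) p - act G (act G (bracket U X)) p
  = s U p *: act G (act H X) p.
Proof.
move=> hX Op; have nij := hn_nijU N hX Op.
have sX := hX.1; have sGU := (horizontal_actG sU).1; have sGX := (horizontal_actG sX).1.
have E1 := bracket_vanishingl hD oO sGU sGX (hn_GU N) Op.
have E2 : act G (bracket (act G U) X) p = 0.
  by rewrite /act (bracket_vanishingl hD oO sGU sX (hn_GU N) Op) mul0mx.
rewrite scaleNr in nij; exact: nijenhuis_split E1 E2 nij.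
Qed.

Lemma gdot_bracketU X Y p : hz X -> hz Y -> O p ->
  gdot g p (bracket U (act G X) p) (Y p) + gdot g p (bracket U X p) (act G Y p)
  = s U p * gdot g p (act H X p) (Y p).
Proof.
move=> hX hY Op; have := f_equal (fun v => gdot g p v (act G Y p)) (nijenhuisU hX Op).
rewrite gdotBl // gdotZl // !gdot_actG_actG //.
rewrite (hn_skewG N (bracket U X) Y Op) opprK.
exact.
Qed.

(** Closedness on (U, X, Y) differentiates g(X, G Y) along [U]. By torsion-freeness the derivatives
    along [U] become brackets with [U] plus derivatives of [U], and [gdot_bracketU] cancels the
    brackets. What is left is the Killing equation with G Y in place of Y. *)
Lemma killing_horizontal0 X Y p : hz X -> hz Y -> O p ->
  gdot g p (D X U p) (act G Y p) + gdot g p (X p) (D (act G Y) U p) = 0.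
Proof.
move=> hX hY Op; have sX := hX.1; have sY := hY.1.
have sGY := (horizontal_actG sY).1.
have cl := dform_closed hg hD oO sU sU sX sY Op.
have L := lie_dform_horizontal sU hX hY Op.
have dU0 Z q : hz Z -> O q -> dform g D U U Z q = 0.
  move=> [sZ hZ] Oq; rewrite (hn_du N) // gdot_actG_U // (hZ q Oq).2.
  by rewrite gdotC // (hn_UV N) //; ring.
have dUN Z q : dform g D U Z U q = - dform g D U U Z q by rewrite /dform opprB.
have L2 : lie_deriv X (dform g D U Y U) p = 0.
  by apply: (lie_deriv_cst _ oO Op) => q Oq; rewrite dUN dU0 // oppr0.
have L3 : lie_deriv Y (dform g D U U X) p = 0.
  exact: (lie_deriv_cst Y oO Op (fun q => dU0 X q hX)).
have sUX := smooth_bracket sU sX; have sXY := smooth_bracket sX sY.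
have sYU := smooth_bracket sY sU.
have d1 := eval_du (hn_du N sUX sY Op) (hY.2 p Op).2 (gdot_V_bracketU hX Op).
have d2 := eval_du (hn_du N sXY sU Op) (etrans (gdotC hg _ _ _) (hn_UV N Op))
  (gdot_V_bracket hX hY Op).
have bVYU : gdot g p (V p) (bracket Y U p) = s Y p.
  by rewrite (bracketC U Y) gdotNr // (gdot_V_bracketU hY Op) opprK.
have d3 := eval_du (hn_du N sYU sX Op) (hX.2 p Op).2 bVYU.
have bGU : gdot g p (bracket X Y p) (act G U p) = 0 by rewrite (hn_GU N Op) gdot0r.
have bGX : gdot g p (bracket Y U p) (act G X p) = - gdot g p (bracket U Y p) (act G X p).
  by rewrite (bracketC U Y) gdotNl.
have tX : gdot g p (D U X p) (act G Y p)
    = gdot g p (bracket U X p) (act G Y p) + gdot g p (D X U p) (act G Y p).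
  by rewrite -gdotDl -(nabla_torsion_free hD oO sU sX Op) subrK.
have tY : gdot g p (X p) (D U (act G Y) p)
    = gdot g p (bracket U (act G Y) p) (X p) + gdot g p (X p) (D (act G Y) U p).
  rewrite (gdotC hg _ (bracket U (act G Y) p)).
  by rewrite -gdotDr // -(nabla_torsion_free hD oO sU sGY Op) subrK.
have tH := gdotC hg p (act H Y p) (X p).
exact: (killing_scalar cl L L2 L3 d1 d2 d3 bGU bGX tX tY tH (gdot_bracketU hY hX Op)).
Qed.

Lemma nabla_actG_actG X W p : hz X -> smooth_vf O W -> O p ->
  D (act G (act G X)) W p = - D X W p.
Proof.
move=> hX sW Op; have sX := hX.1.
have sGGX := hn_smoothG N (hn_smoothG N sX).
rewrite -(nabla_oppl hD oO sX sW Op).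
apply: (nabla_eql hD oO sGGX (smooth_vfN sX) sW _ Op) => q Oq.
exact: (hn_GG N Oq (hX.2 q Oq).1 (hX.2 q Oq).2).
Qed.

Lemma killing_horizontal X Y p : hz X -> hz Y -> O p ->
  gdot g p (D X U p) (Y p) + gdot g p (X p) (D Y U p) = 0.
Proof.
move=> hX hY Op; have hGY := horizontal_actG hY.1.
have := killing_horizontal0 hX hGY Op.
rewrite (nabla_actG_actG hY sU Op) (hn_GG N Op (hY.2 p Op).1 (hY.2 p Op).2).
rewrite !gdotNr //; lra.
Qed.

(** The Killing equation kills the symmetric part of nabla U, and [hn_du] gives twice the skew part.
    As G is skew, the result is nabla_X U = - G X on horizontal vectors. *)
Lemma nablaU_horizontal X Y p : hz X -> hz Y -> O p ->
  gdot g p (D X U p) (Y p) = gdot g p (X p) (act G Y p).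
Proof.
move=> hX hY Op; have K := killing_horizontal hX hY Op.
have du := eval_du (hn_du N hX.1 hY.1 Op) (hY.2 p Op).2 (hX.2 p Op).2.
rewrite /dform (gdotC hg p (D Y U p)) in du.
exact: half_antisymmetric K du.
Qed.

Lemma gdot_nablaU_U X p : smooth_vf O X -> O p -> gdot g p (D X U p) (U p) = 0.
Proof.
move=> sX Op; have := lie_inner hD oO sX sU sU Op.
rewrite (lie_deriv_cst X oO Op (hn_UU N)) (gdotC hg _ (U p)); lra.
Qed.

Lemma nablaUU Y p : hz Y -> O p -> gdot g p (D U U p) (Y p) = 0.
Proof.
move=> [sY hY] Op.
have := eval_du (hn_du N sU sY Op) (hY p Op).2 (etrans (gdotC hg _ _ _) (hn_UV N Op)).
rewrite /dform gdot_actG_U // gdot_nablaU_U //; lra.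
Qed.

(** Here [dform g D U V Y] equals - s(Y), which is exactly the contribution of g(nabla_Y U, V);
    hence the other term is 0. *)
Lemma nablaVU Y p : hz Y -> O p -> gdot g p (D V U p) (Y p) = 0.
Proof.
move=> [sY hY] Op.
have := eval_du (hn_du N sV sY Op) (hY p Op).2 (hn_VV N Op).
rewrite /dform gdot_actG_V // -(hn_s N sY Op); lra.
Qed.

Definition hor X : vfield M := fun x =>
  X x + ((- inner g U X x) *: U x + (- inner g V X x) *: V x).

Let smooth_coef X W : smooth_vf O W -> smooth_vf O X ->
  smooth_fun O (fun x => - inner g W X x).
Proof. by move=> sW sX; exact: (smooth_funN oO (smooth_inner hg oO sW sX)). Qed.

Let smooth_part X W : smooth_vf O W -> smooth_vf O X ->
  smooth_vf O (fun x => (- inner g W X x) *: W x).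
Proof. by move=> sW sX; exact: (smooth_vfZ (smooth_coef sW sX) sW). Qed.

Lemma horizontal_hor X : smooth_vf O X -> hz (hor X).
Proof.
move=> sX; split.
  exact: (smooth_vfD sX (smooth_vfD (smooth_part sU sX) (smooth_part sV sX))).
move=> q Oq; rewrite /hor !(gdotDr hg) !(gdotZr hg) (hn_UU N Oq) (hn_VV N Oq).
rewrite (gdotC hg _ (V q) (U q)) (hn_UV N Oq) /inner; split; ring.
Qed.

Lemma nabla_hor X W p : smooth_vf O X -> smooth_vf O W -> O p ->
  D (hor X) W p = D X W p + ((- inner g U X p) *: D U W p + (- inner g V X p) *: D V W p).
Proof.
move=> sX sW Op; have sP := smooth_part sU sX; have sQ := smooth_part sV sX.
rewrite (nabla_addl hD oO sX (smooth_vfD sP sQ) sW Op).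
rewrite (nabla_addl hD oO sP sQ sW Op).
rewrite (nabla_scalel hD oO (smooth_coef sU sX) sU sW Op).
by rewrite (nabla_scalel hD oO (smooth_coef sV sX) sV sW Op).
Qed.

Lemma nablaU X Y p : smooth_vf O X -> hz Y -> O p ->
  gdot g p (D X U p) (Y p) = gdot g p (X p) (act G Y p).
Proof.
move=> sX hY Op; have := nablaU_horizontal (horizontal_hor sX) hY Op.
rewrite (nabla_hor sX sU Op) /hor !(gdotDl g) !(gdotZl g).
rewrite (nablaUU hY Op) (nablaVU hY Op) (gdot_actG_U _ Op) (gdot_actG_V _ Op).
lra.
Qed.

(** As [G] is skew, this is g((nabla_X G) Y, Z). *)
Let c X Y Z p := gdot g p (D X (act G Y) p) (Z p) + gdot g p (D X Y p) (act G Z p).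
Let e X Y Z p := c X Y Z p - s X p * gdot g p (act H Y p) (Z p).

Lemma nablaG_skew X Y Z p : hz X -> hz Y -> hz Z -> O p -> c X Y Z p = - c X Z Y p.
Proof.
move=> hX hY hZ Op.
have [sX sY sZ] := And3 hX.1 hY.1 hZ.1.
have sGY := hn_smoothG N sY; have sGZ := hn_smoothG N sZ.
have I1 := smooth_inner hg oO sGY sZ; have I2 := smooth_inner hg oO sY sGZ.
have L := lie_derivD X Op I1 I2.
rewrite (lie_inner hD oO sX sGY sZ Op) (lie_inner hD oO sX sY sGZ Op) in L.
have L0 : lie_deriv X (fun x => inner g (act G Y) Z x + inner g Y (act G Z) x) p = 0.
  by apply: (lie_deriv_cst _ oO Op) => q Oq; rewrite /inner (hn_skewG N) // addNr.
exact: nablaG_skew_scalar L L0 (gdotC hg _ _ _) (gdotC hg _ _ _).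
Qed.

Lemma error_skew X Y Z p : hz X -> hz Y -> hz Z -> O p -> e X Y Z p = - e X Z Y p.
Proof.
move=> hX hY hZ Op; rewrite /e (nablaG_skew hX hY hZ Op) (hn_skewH N Y Z Op).
by rewrite (gdotC hg _ (Y p)); ring.
Qed.

Let r A B C p := gdot g p (D A B p) (act G C p).
Let t A B C p := s A p * gdot g p (B p) (act H C p).

(** The terms [t] and [r] are arranged to telescope: over the cyclic permutations each occurs once
    with either sign, so only the errors survive. *)
Lemma cyclic_term A B C p : hz A -> hz B -> hz C -> O p ->
  lie_deriv A (dform g D U B C) p - dform g D U (bracket A B) C p
  = 2 * (- e A B C p + t A B C p - t C A B p - r A C B p + r B A C p).
Proof.
move=> hA hB hC Op.
have E1 := lie_dform_horizontal hA.1 hB hC Op.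
have E2 := dform_bracket_horizontal hA hB hC Op.
have E3 : gdot g p (bracket A B p) (act G C p) = r A B C p - r B A C p.
  by rewrite -(nabla_torsion_free hD oO hA.1 hB.1 Op) gdotBl.
have E4 := nablaG_skew hA hB hC Op.
rewrite /c (gdotC hg p (D A (act G C) p)) in E4.
exact: cyclic_term_scalar E1 E2 E3 E4 (hn_skewH N B C Op).
Qed.

Lemma error_cyclic X Y Z p : hz X -> hz Y -> hz Z -> O p ->
  e X Y Z p + e Y Z X p + e Z X Y p = 0.
Proof.
move=> hX hY hZ Op.
have cl := dform_closed hg hD oO sU hX.1 hY.1 hZ.1 Op.
exact: cyclic_sum_scalar cl (cyclic_term hX hY hZ Op) (cyclic_term hY hZ hX Op)
  (cyclic_term hZ hX hY Op).
Qed.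

(** Torsion-freeness turns the brackets into covariant derivatives, and skewness of [G] regroups
    these into values of nabla G. *)
Lemma gdot_nijenhuis Y Z W p : hz Y -> hz Z -> hz W -> O p ->
  gdot g p (nijenhuis G Y Z p) (W p)
  = c (act G Y) Z W p - c (act G Z) Y W p + c Y Z (act G W) p - c Z Y (act G W) p.
Proof.
move=> hY hZ hW Op; have [sY sZ sW] := And3 hY.1 hZ.1 hW.1.
have sGY := hn_smoothG N sY; have sGZ := hn_smoothG N sZ.
have tor A B C (sA : smooth_vf O A) (sB : smooth_vf O B) :
  gdot g p (bracket A B p) (C p) = gdot g p (D A B p) (C p) - gdot g p (D B A p) (C p).
  by rewrite -(nabla_torsion_free hD oO sA sB Op) gdotBl.
rewrite /nijenhuis !gdotBl // gdotDl //.
have E1 := tor _ _ W sGY sGZ.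
have E2 := etrans (hn_skewG N (bracket (act G Y) Z) W Op)
  (f_equal -%R (tor _ _ (act G W) sGY sZ)).
have E3 := etrans (hn_skewG N (bracket Y (act G Z)) W Op)
  (f_equal -%R (tor _ _ (act G W) sY sGZ)).
have E4 := hn_skewG N (act G (bracket Y Z)) W Op.
have E5 := etrans (hn_skewG N (bracket Y Z) (act G W) Op)
  (f_equal -%R (tor _ _ (act G (act G W)) sY sZ)).
exact: nijenhuis_scalar E1 E2 E3 E4 E5.
Qed.

(** The [s] terms in [hn_nij] are those subtracted in [e], so the Nijenhuis condition is a four-term
    relation between errors. The cyclic identity at (Y, Z, G W) merges two of them into the
    right-hand side. *)
Lemma error_nijenhuis Y Z W p : hz Y -> hz Z -> hz W -> O p ->
  e (act G Y) Z W p - e (act G Z) Y W p = e (act G W) Y Z p.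
Proof.
move=> hY hZ hW Op; have hGW := horizontal_actG hW.1.
have E1 := etrans (esym (gdot_nijenhuis hY hZ hW Op)) (hn_nij N hY hZ hW Op).
have E2 := error_cyclic hY hZ hGW Op.
have E3 := error_skew hZ hGW hY Op.
have E4 := hn_skewG N (act H Y) W Op.
have E5 := hn_skewG N (act H Z) W Op.
exact: error_nijenhuis_scalar E1 E2 E3 E4 E5.
Qed.

(** Put x = e(G X, Y, Z), y = e(G Y, Z, X), z = e(G Z, X, Y). By skewness, [error_nijenhuis] at (Z,
    X, Y) and at (X, Y, Z) reads z + x = y and x + y = z, hence x = 0. *)
Lemma error_actG X Y Z p : hz X -> hz Y -> hz Z -> O p -> e (act G X) Y Z p = 0.
Proof.
move=> hX hY hZ Op.
have E1 := error_nijenhuis hZ hX hY Op; have E2 := error_nijenhuis hX hY hZ Op.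
have S1 := error_skew (horizontal_actG hY.1) hZ hX Op.
have S2 := error_skew (horizontal_actG hX.1) hY hZ Op.
exact: polarization0 E1 E2 S1 S2.
Qed.

(** [error_actG] taken at G X reaches the first argument G G X = - X. As this equality of fields
    holds on [O], it is passed through the connection by locality, and [s] is first unfolded into
    nabla U. *)
Lemma nablaG X Y Z p : hz X -> hz Y -> hz Z -> O p ->
  gdot g p (D X (act G Y) p) (Z p) + gdot g p (D X Y p) (act G Z p)
  = s X p * gdot g p (act H Y p) (Z p).
Proof.
move=> hX hY hZ Op; have hGX := horizontal_actG hX.1.
have := error_actG hGX hY hZ Op; rewrite /e /c.
rewrite (hn_s N hX.1 Op) (hn_s N (horizontal_actG hGX.1).1 Op).
rewrite (nabla_actG_actG hX (horizontal_actG hY.1).1 Op).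
rewrite (nabla_actG_actG hX hY.1 Op) (nabla_actG_actG hX sU Op).
rewrite !gdotNl //; lra.
Qed.

End HalfNormal.

(** * The two half-normal structures of a normal frame *)

Lemma J0_sqr (R : realType) N : @J0 R N *m @J0 R N = - 1%:M.
Proof.
rewrite /J0 mulmx_block !mul0mx !mulmx0 !mul1mx !mulmx1 !add0r !addr0.
by rewrite [X in _ = - X]scalar_mx_block opp_block_mx oppr0.
Qed.

Lemma half_scalarD (R : realFieldType) (d a b : R) :
  2^-1 * d = a + 2^-1 * b -> d = 2 * a + b.
Proof. lra. Qed.

Lemma half_scalarB (R : realFieldType) (d a b : R) :
  2^-1 * d = a - 2^-1 * b -> d = 2 * a - b.
Proof. lra. Qed.

Lemma opp_of_sum0 (V : zmodType) (a b c : V) : 0 = a + b -> b = c -> - a = c.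
Proof. by move=> E <-; apply/eqP; rewrite eqr_oppLR -subr_eq0 opprK -E. Qed.

Section NormalFrame.
Context {R : realType} {n : nat} (M : complex_manifold R n.*2.+1).
Variables (g : M -> 'M[R]_(n.*2.+1 + n.*2.+1))
  (D : vfield M -> vfield M -> vfield M).
Hypotheses (hg : semi_riemannian g) (hherm : hermitian_metric g).
Hypothesis hD : levi_civita g D.
Variables (O0 O : set M) (t : cform1 M) (F : frame M).
Hypotheses (cf : contact_frame g D O0 t F) (oO : open O) (sub : O `<=` O0).
Implicit Types (X Y Z : vfield M) (q : M) (v w : 'rV[R]_(n.*2.+1 + n.*2.+1)).

Local Notation U := (fU F).
Local Notation V := (fV F).
Local Notation G := (fG F).
Local Notation H := (fH F).
Local Notation J := (@J0 R n.*2.+1).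

Lemma gdot_J q v w : gdot g q (v *m J) w = - gdot g q v (w *m J).
Proof.
rewrite -(hherm q v (w *m J)) -mulmxA J0_sqr mulmxN mulmx1.
by rewrite (gdotNr hg) opprK.
Qed.

Lemma frame_GJ q : O q -> G q *m J = - (J *m G q).
Proof. by move=> /sub Oq; rewrite -[J *m _]/(Jtensor M q *m _) (GJ_anti cf Oq) opprK. Qed.

Lemma frame_H q v : O q -> v *m H q = v *m J *m G q.
Proof. by move=> /sub Oq; rewrite (fH_def cf Oq) mulmxA. Qed.

Lemma frame_V q : O q -> V q = - (U q *m J).
Proof. by move=> /sub Oq; rewrite (fV_def cf Oq). Qed.

Lemma frame_GU q : O q -> U q *m G q = 0.
Proof. by move=> /sub Oq; exact: (G_U cf Oq). Qed.

Lemma frame_HU q : O q -> U q *m H q = 0.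
Proof.
move=> Oq; rewrite frame_H // -mulmxA -[J *m _]opprK -frame_GJ // mulmxN mulmxA.
by rewrite frame_GU // mul0mx oppr0.
Qed.

Lemma frame_GV q : O q -> V q *m G q = 0.
Proof. by move=> Oq; rewrite frame_V // mulNmx -frame_H // frame_HU // oppr0. Qed.

Lemma frame_HV q : O q -> V q *m H q = 0.
Proof.
move=> Oq; rewrite frame_H // frame_V // !mulNmx -!mulmxA.
by rewrite [J *m (J *m _)]mulmxA J0_sqr mulNmx mul1mx mulmxN opprK frame_GU.
Qed.

Lemma frame_HG q v : O q -> v *m G q *m H q = - (v *m H q *m G q).
Proof.
move=> Oq; rewrite !frame_H // -[v *m G q *m J]mulmxA frame_GJ //.
by rewrite mulmxN mulNmx -!mulmxA.
Qed.

Lemma frame_skewG q v w : O q -> gdot g q (v *m G q) w = - gdot g q v (w *m G q).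
Proof. by move=> /sub Oq; exact: (G_skew cf). Qed.

Lemma frame_skewH q v w : O q -> gdot g q (v *m H q) w = - gdot g q v (w *m H q).
Proof.
move=> Oq; rewrite !frame_H // frame_skewG // gdot_J opprK -mulmxA frame_GJ //.
by rewrite mulmxN (gdotNr hg) mulmxA.
Qed.

Lemma frame_u X q : O q -> pair1 (fu F) X q = gdot g q (U q) (X q).
Proof. by move=> /sub Oq; rewrite (U_dual cf _ Oq). Qed.

Lemma frame_v X q : O q -> pair1 (fv F) X q = gdot g q (V q) (X q).
Proof. by move=> /sub Oq; rewrite (V_dual cf _ Oq). Qed.

Lemma frame_UU q : O q -> gdot g q (U q) (U q) = 1.
Proof. by move=> Oq; rewrite -frame_u // (u_U cf) //; exact: sub. Qed.

Lemma frame_VV q : O q -> gdot g q (V q) (V q) = 1.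
Proof.
by move=> Oq; rewrite frame_V // (gdotNl g) (gdotNr hg) opprK hherm frame_UU.
Qed.

Lemma frame_UV q : O q -> gdot g q (U q) (V q) = 0.
Proof. by move=> Oq; apply: (UV_orth cf); exact: sub. Qed.

Let horizontal_sqr q (A : 'M[R]_(n.*2.+1 + n.*2.+1)) v : O q ->
  A *m A = - 1%:M + fu F q *m U q + fv F q *m V q ->
  gdot g q (U q) v = 0 -> gdot g q (V q) v = 0 -> v *m A *m A = - v.
Proof.
move=> Oq E Uv Vv; rewrite -mulmxA E !mulmxDr mulmxN mulmx1 !mulmxA.
have -> : v *m fu F q = 0.
  by apply/matrixP => i j; rewrite !ord1 -(U_dual cf v (sub Oq)) Uv mxE.
have -> : v *m fv F q = 0.
  by apply/matrixP => i j; rewrite !ord1 -(V_dual cf v (sub Oq)) Vv mxE.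
by rewrite !mul0mx !addr0.
Qed.

Lemma frame_GG q v : O q -> gdot g q (U q) v = 0 -> gdot g q (V q) v = 0 ->
  v *m G q *m G q = - v.
Proof. by move=> Oq; apply: horizontal_sqr => //; apply: (G_sqr cf); exact: sub. Qed.

Lemma frame_HH q v : O q -> gdot g q (U q) v = 0 -> gdot g q (V q) v = 0 ->
  v *m H q *m H q = - v.
Proof. by move=> Oq; apply: horizontal_sqr => //; apply: (H_sqr cf); exact: sub. Qed.

Lemma smooth_frame_U : smooth_vf O U.
Proof. exact: smooth_vf_sub sub (fU_smooth cf). Qed.

Lemma smooth_frame_V : smooth_vf O V.
Proof.
apply: smooth_vf_eq (smooth_vfN (smooth_act_J oO smooth_frame_U)) => q Oq.
by rewrite frame_V.
Qed.

Lemma smooth_frame_G X : smooth_vf O X -> smooth_vf O (act G X).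
Proof. exact: (fG_smooth cf). Qed.

Lemma smooth_frame_H X : smooth_vf O X -> smooth_vf O (act H X).
Proof.
move=> sX; apply: smooth_vf_eq (smooth_frame_G (smooth_act_J oO sX)) => q Oq.
by rewrite /act frame_H.
Qed.

Let sU := smooth_frame_U.
Let sV := smooth_frame_V.

Let ext_deriv_dform (a : form1 M) W X Y q : smooth_vf O W ->
  smooth_vf O X -> smooth_vf O Y -> O q ->
  (forall Z q, O q -> pair1 a Z q = gdot g q (W q) (Z q)) ->
  ext_deriv a X Y q = 2^-1 * dform g D W X Y q.
Proof.
move=> sW sX sY Oq aW; rewrite (dformE hg hD oO sW sX sY Oq) /ext_deriv.
have E A B (f := pair1 a B) (h := inner g W B) : lie_deriv A f q = lie_deriv A h q.
  by apply: (lie_deriv_eq _ oO) => // q' Oq'; exact: aW.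
exact: (f_equal (fun x => 2^-1 * x)
  (f_equal2 (fun x y => x - y) (f_equal2 (fun x y => x - y) (E X Y) (E Y X)) (aW _ _ Oq))).
Qed.

Lemma frame_du X Y q : smooth_vf O X -> smooth_vf O Y -> O q ->
  dform g D U X Y q = 2 * gdot g q (X q) (act G Y q)
  + (sigma g D F X q * gdot g q (V q) (Y q) - sigma g D F Y q * gdot g q (V q) (X q)).
Proof.
move=> sX sY Oq; have := du_eq cf oO sub sX sY Oq.
rewrite (ext_deriv_dform sU sX sY Oq frame_u) /wedge !frame_v // => E.
exact: half_scalarD E.
Qed.

Lemma frame_dv X Y q : smooth_vf O X -> smooth_vf O Y -> O q ->
  dform g D V X Y q = 2 * gdot g q (X q) (act H Y q)
  - (sigma g D F X q * gdot g q (U q) (Y q) - sigma g D F Y q * gdot g q (U q) (X q)).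
Proof.
move=> sX sY Oq; have := dv_eq cf oO sub sX sY Oq.
rewrite (ext_deriv_dform sV sX sY Oq frame_v) /wedge !frame_u // => E.
exact: half_scalarB E.
Qed.

(** Differentiating g(U, V) = 0 shows that the form attached to the exchanged pair (V, U) is -
    sigma. *)
Lemma sigma_skew X q : smooth_vf O X -> O q ->
  - sigma g D F X q = gdot g q (D X V q) (U q).
Proof.
move=> sX Oq; have := lie_inner hD oO sX sU sV Oq.
rewrite (lie_deriv_cst X oO Oq frame_UV) => E.
exact: opp_of_sum0 E (gdotC hg _ _ _).
Qed.

Hypothesis normalO :
  (forall X Y p, smooth_vf O X -> smooth_vf O Y ->
       horizontal g O F X -> horizontal g O F Y -> O p ->
       tensorS g D F X Y p = 0 /\ tensorT g D F X Y p = 0) /\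
  (forall X p, smooth_vf O X -> O p ->
       tensorS g D F U X p = 0 /\ tensorT g D F V X p = 0).

Let sigma_vanishing Z q : smooth_vf O Z -> (forall q, O q -> Z q = 0) -> O q ->
  sigma g D F Z q = 0.
Proof.
by move=> sZ Z0 Oq; rewrite /sigma (nabla_vanishingl hD oO sZ sU) // (gdot0l g).
Qed.

(** Every other term of S(U, X) contains G U, H U, v(U), or the product of [U] with an image of [G]
    or [H]. *)
Lemma frame_nijU X q : horizontal_field g O U V X -> O q ->
  nijenhuis G U X q = - sigma g D F U q *: act G (act H X) q.
Proof.
move=> [sX hX] Oq; have [+ _] := normalO.2 X q sX Oq.
rewrite /tensorS.
have -> : gdot g q (U q) (act G X q) = 0.
  by rewrite (gdotC hg) frame_skewG // frame_GU // (gdot0r hg) oppr0.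
have -> : gdot g q (U q) (act H X q) = 0.
  by rewrite (gdotC hg) frame_skewH // frame_HU // (gdot0r hg) oppr0.
have -> : act H U q = 0 := frame_HU Oq.
have -> : pair1 (fv F) U q = 0 by rewrite frame_v // (gdotC hg) frame_UV.
rewrite (sigma_vanishing (smooth_frame_G sU) frame_GU Oq).
have -> : act G (act H U) q = 0 by rewrite /act frame_HU // mul0mx.
rewrite !mulr0 !scale0r !(scaler0, addr0, subr0, oppr0) scaleNr.
by move=> E; apply/eqP; rewrite -addr_eq0; apply/eqP.
Qed.

(** The double sign is that of the exchanged data: [s] is now - sigma, and G H has been rewritten as
    - H G. *)
Lemma frame_nijV X q : horizontal_field g O V U X -> O q ->
  nijenhuis H V X q = - - sigma g D F V q *: act H (act G X) q.
Proof.
move=> [sX hX] Oq; have [_] := normalO.2 X q sX Oq.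
rewrite /tensorT.
have -> : gdot g q (V q) (act G X q) = 0.
  by rewrite (gdotC hg) frame_skewG // frame_GV // (gdot0r hg) oppr0.
have -> : gdot g q (V q) (act H X q) = 0.
  by rewrite (gdotC hg) frame_skewH // frame_HV // (gdot0r hg) oppr0.
have -> : act G V q = 0 := frame_GV Oq.
have -> : pair1 (fu F) V q = 0 by rewrite frame_u // frame_UV.
rewrite (sigma_vanishing (smooth_frame_H sV) frame_HV Oq).
have -> : act G (act H V) q = 0 by rewrite /act frame_HV // mul0mx.
have -> : act H (act G X) q = - act G (act H X) q by exact: frame_HG.
rewrite !mulr0 !scale0r !(scaler0, addr0, subr0, oppr0) opprK scalerN.
by move=> E; apply/eqP; rewrite -addr_eq0; apply/eqP.
Qed.

Let horizontalE X : horizontal_field g O U V X ->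
  [/\ smooth_vf O X, horizontal g O F X,
      forall q, O q -> pair1 (fu F) X q = 0 & forall q, O q -> pair1 (fv F) X q = 0].
Proof.
move=> [sX hX]; split=> // q Oq; last 2 first.
- by rewrite frame_u // (hX q Oq).1.
- by rewrite frame_v // (hX q Oq).2.
by rewrite !(gdotC hg _ (X q)); exact: hX.
Qed.

Let gdot_sumS q (w u v k x1 x2 x3 x4 z : 'rV[R]_(n.*2.+1 + n.*2.+1))
    (a b c1 c2 c3 c4 : R) :
  w + a *: u - b *: v + k + c1 *: x1 - c2 *: x2 + c3 *: x3 - c4 *: x4 = 0 ->
  gdot g q u z = 0 -> gdot g q v z = 0 -> k = 0 ->
  gdot g q w z = - c1 * gdot g q x1 z + c2 * gdot g q x2 z
    - c3 * gdot g q x3 z + c4 * gdot g q x4 z.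
Proof.
move=> E uz vz k0; move: (f_equal (fun v => gdot g q v z) E).
by rewrite k0 !(gdotDl g, gdotNl g, gdotZl g, gdot0l g) uz vz; lra.
Qed.

Let gdot_sumT q (w u v k x1 x2 x3 x4 z : 'rV[R]_(n.*2.+1 + n.*2.+1))
    (a b c1 c2 c3 c4 : R) :
  w - a *: u + b *: v + k + c1 *: x1 - c2 *: x2 + c3 *: x3 - c4 *: x4 = 0 ->
  gdot g q u z = 0 -> gdot g q v z = 0 -> k = 0 ->
  gdot g q w z = - - c2 * gdot g q x2 z + - c1 * gdot g q x1 z
    - - c3 * gdot g q (- x3) z + - c4 * gdot g q (- x4) z.
Proof.
move=> E uz vz k0; move: (f_equal (fun v => gdot g q v z) E).
by rewrite k0 !(gdotDl g, gdotNl g, gdotZl g, gdot0l g) uz vz; lra.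
Qed.

Lemma frame_nij X Y Z q : horizontal_field g O U V X ->
  horizontal_field g O U V Y -> horizontal_field g O U V Z -> O q ->
  gdot g q (nijenhuis G X Y q) (Z q)
  = - sigma g D F (act G Y) q * gdot g q (act H X q) (Z q)
    + sigma g D F (act G X) q * gdot g q (act H Y q) (Z q)
    - sigma g D F X q * gdot g q (act G (act H Y) q) (Z q)
    + sigma g D F Y q * gdot g q (act G (act H X) q) (Z q).
Proof.
move=> hX hY [_ hZ] Oq.
have [sX h'X uX vX] := horizontalE hX; have [sY h'Y uY vY] := horizontalE hY.
have [E _] := normalO.1 X Y q sX sY h'X h'Y Oq.
apply: (gdot_sumS E (hZ q Oq).1 (hZ q Oq).2).
by rewrite (vX q Oq) (vY q Oq) !scale0r subr0 scaler0.
Qed.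

Lemma frame_nij' X Y Z q : horizontal_field g O V U X ->
  horizontal_field g O V U Y -> horizontal_field g O V U Z -> O q ->
  gdot g q (nijenhuis H X Y q) (Z q)
  = - - sigma g D F (act H Y) q * gdot g q (act G X q) (Z q)
    + - sigma g D F (act H X) q * gdot g q (act G Y q) (Z q)
    - - sigma g D F X q * gdot g q (act H (act G Y) q) (Z q)
    + - sigma g D F Y q * gdot g q (act H (act G X) q) (Z q).
Proof.
move=> hX hY [_ hZ] Oq.
have swap W : horizontal_field g O V U W -> horizontal_field g O U V W.
  by move=> [sW hW]; split=> // q' Oq'; have [] := hW q' Oq'.
have [sX h'X uX vX] := horizontalE (swap _ hX).
have [sY h'Y uY vY] := horizontalE (swap _ hY).
have [_ E] := normalO.1 X Y q sX sY h'X h'Y Oq.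
have -> : act H (act G Y) q = - act G (act H Y) q by exact: frame_HG.
have -> : act H (act G X) q = - act G (act H X) q by exact: frame_HG.
apply: (gdot_sumT E (hZ q Oq).2 (hZ q Oq).1).
by rewrite (uX q Oq) (uY q Oq) !scale0r subr0 scaler0.
Qed.

Lemma half_normal_frame : half_normal g D O U V G H (sigma g D F).
Proof.
apply: HalfNormal.
- exact: oO.
- exact: sU.
- exact: sV.
- exact: smooth_frame_G.
- exact: smooth_frame_H.
- exact: frame_UU.
- exact: frame_VV.
- exact: frame_UV.
- by move=> X Y q; exact: frame_skewG.
- by move=> X Y q; exact: frame_skewH.
- exact: frame_GU.
- exact: frame_GV.
- exact: frame_HU.
- exact: frame_HV.
- by move=> X q; exact: frame_GG.
- by move=> X q; exact: frame_HG.
- by [].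
- exact: frame_du.
- exact: frame_dv.
- exact: frame_nijU.
- exact: frame_nij.
Qed.

Lemma half_normal_frame' :
  half_normal g D O V U H G (fun X q => - sigma g D F X q).
Proof.
apply: HalfNormal.
- exact: oO.
- exact: sV.
- exact: sU.
- exact: smooth_frame_H.
- exact: smooth_frame_G.
- exact: frame_VV.
- exact: frame_UU.
- by move=> q Oq; rewrite (gdotC hg) frame_UV.
- by move=> X Y q; exact: frame_skewH.
- by move=> X Y q; exact: frame_skewG.
- exact: frame_HV.
- exact: frame_HU.
- exact: frame_GV.
- exact: frame_GU.
- by move=> X q Oq vX uX; exact: frame_HH.
- move=> X q Oq; have -> : act H (act G X) q = - act G (act H X) q.
    exact: frame_HG.
  by rewrite opprK.
- exact: sigma_skew.
- move=> X Y q sX sY Oq; rewrite (frame_dv sX sY Oq); ring.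
- move=> X Y q sX sY Oq; rewrite (frame_du sX sY Oq); ring.
- exact: frame_nijV.
- exact: frame_nij'.
Qed.

End NormalFrame.

(** * The second fundamental form *)

Section QuaternionSubmanifold.
Context {R : realType} {k m : nat} (M : manifold R k) (Mb : manifold R m).
Variables (g : Mb -> 'M[R]_m) (D : vfield Mb -> vfield Mb -> vfield Mb).
Variables (iota : M -> Mb) (B : set Mb) (W : set M) (p : M).
Variables (U V : vfield Mb) (G H : tensor11 Mb) (s s' : vfield Mb -> Mb -> R).
Hypotheses (hg : semi_riemannian g) (hD : levi_civita g D).
Hypotheses (smooth_iota : smooth_map iota) (oW : open W) (Wp : W p).
Hypothesis B_dom : B `<=` dom Mb (iota p).
Hypothesis N : half_normal g D B U V G H s.
Hypothesis N' : half_normal g D B V U H G s'.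
Hypothesis immersed : row_free (dmap iota p).
Hypothesis WB : forall q, W q -> B (iota q).
Hypothesis tangentU : forall q, W q -> (U (iota q) <= dmap iota q)%MS.
Hypothesis tangentV : forall q, W q -> (V (iota q) <= dmap iota q)%MS.
Hypothesis tangentG : forall q, W q -> stablemx (dmap iota q) (G (iota q)).
Hypothesis tangentH : forall q, W q -> stablemx (dmap iota q) (H (iota q)).
Implicit Types (X Y Z : vfield Mb) (z : 'rV[R]_m).

Let oB := hn_open N.
Let sU := hn_smoothU N.
Let sV := hn_smoothV N.
Let y := iota p.
Let By : B y := WB Wp.

Definition tangent_field X : Prop :=
  smooth_vf B X /\ forall q, W q -> (X (iota q) <= dmap iota q)%MS.

(** These vectors form TM^perp at [p], which contains the radical, so a normal vector may also be
    tangent. *)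
Let normal z : Prop := forall v, (v <= dmap iota p)%MS -> gdot g y v z = 0.
Let hz := horizontal_field g B U V.

Let hz_swap X : hz X -> horizontal_field g B V U X.
Proof. by move=> [sX hX]; split=> // q Bq; have [] := hX q Bq. Qed.

Let tangent_U : tangent_field U.
Proof. by split. Qed.

Let tangent_V : tangent_field V.
Proof. by split. Qed.

Let tangent_actG X : tangent_field X -> tangent_field (act G X).
Proof.
move=> [sX tX]; split=> [|q Wq]; first exact: (hn_smoothG N).
by apply: submx_trans (tangentG Wq); apply: submxMr; exact: tX.
Qed.

Let tangent_actH X : tangent_field X -> tangent_field (act H X).
Proof.
move=> [sX tX]; split=> [|q Wq]; first exact: (hn_smoothH N).
by apply: submx_trans (tangentH Wq); apply: submxMr; exact: tX.
Qed.

Let tangent_hor X : tangent_field X -> tangent_field (hor g U V X).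
Proof.
move=> [sX tX]; split=> [|q Wq].
  exact: (horizontal_hor hg N sX).1.
by rewrite /hor !addmx_sub ?scalemx_sub ?tX ?tangentU ?tangentV.
Qed.

Let horizontal_actH X : smooth_vf B X -> hz (act H X).
Proof.
move=> sX; have [sHX hHX] := horizontal_actG hg N' sX.
by split=> // q Bq; have [] := hHX q Bq.
Qed.

Let normal_actG z : normal z -> normal (z *m G y).
Proof.
move=> nz v tv; rewrite -[gdot _ _ _ _]opprK -(hn_skewG N (fun=> v) (fun=> z) By).
by rewrite nz ?oppr0 //; apply: submx_trans (tangentG Wp); exact: submxMr.
Qed.

Let normal_actH z : normal z -> normal (z *m H y).
Proof.
move=> nz v tv; rewrite -[gdot _ _ _ _]opprK -(hn_skewH N (fun=> v) (fun=> z) By).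
by rewrite nz ?oppr0 //; apply: submx_trans (tangentH Wp); exact: submxMr.
Qed.

Let normalU z : normal z -> gdot g y (U y) z = 0.
Proof. by apply; exact: tangentU. Qed.

Let normalV z : normal z -> gdot g y (V y) z = 0.
Proof. by apply; exact: tangentV. Qed.

(** The formulas for nabla U and nabla G are tested on horizontal fields. Projecting a coordinate
    field makes it horizontal and keeps its value at [p], since [z] is orthogonal to the tangent
    vectors U and V. *)
Let extend_normal z : normal z -> exists2 Z, hz Z & Z y = z.
Proof.
move=> nz; have sZ : smooth_vf B (chart_field y z).
  exact: smooth_vf_sub B_dom (@smooth_chart_field _ _ _ y z).
exists (hor g U V (chart_field y z)); first exact: (horizontal_hor hg N sZ).
rewrite /hor /inner chart_field_self normalU // normalV //.
by rewrite oppr0 !scale0r !addr0.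
Qed.

(** By torsion-freeness the difference is the product of [z] with a bracket of fields tangent along
    [W]. *)
Let second_form_sym X Y z : tangent_field X -> tangent_field Y -> normal z ->
  gdot g y (D X Y y) z = gdot g y (D Y X y) z.
Proof.
move=> [sX tX] [sY tY] nz; apply/eqP; rewrite -subr_eq0 -gdotBl; apply/eqP.
rewrite (nabla_torsion_free hD oB sX sY By); apply: nz.
by apply: (bracket_tangent smooth_iota oB oW Wp sX sY) => // q Wq; split; auto.
Qed.

Let second_form_U X z : tangent_field X -> normal z -> gdot g y (D X U y) z = 0.
Proof.
move=> tX nz; have [Z hZ Zy] := extend_normal nz.
rewrite -{1}Zy (nablaU hg hD N tX.1 hZ By) -[gdot _ _ _ _]opprK.
rewrite -(hn_skewG N X Z By) Zy nz ?oppr0 //.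
exact: ((tangent_actG tX).2 p Wp).
Qed.

Let second_form_V X z : tangent_field X -> normal z -> gdot g y (D X V y) z = 0.
Proof.
move=> tX nz; have [Z hZ Zy] := extend_normal nz.
rewrite -{1}Zy (nablaU hg hD N' tX.1 (hz_swap hZ) By) -[gdot _ _ _ _]opprK.
rewrite -(hn_skewH N X Z By) Zy nz ?oppr0 //.
exact: ((tangent_actH tX).2 p Wp).
Qed.

(** Symmetry moves the removed multiples of U and V to the second argument, where [second_form_U]
    and [second_form_V] apply. *)
Let second_form_hor X Y z : tangent_field X -> tangent_field Y -> normal z ->
  gdot g y (D (hor g U V X) Y y) z = gdot g y (D X Y y) z.
Proof.
move=> tX tY nz; rewrite (nabla_hor hg hD N tX.1 tY.1 By) !(gdotDl g) !(gdotZl g).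
rewrite (second_form_sym tangent_U tY nz) (second_form_U tY nz).
rewrite (second_form_sym tangent_V tY nz) (second_form_V tY nz).
by rewrite !mulr0 !addr0.
Qed.

(** The right-hand side of [nablaG] pairs the tangent vector H Y with [z] and vanishes; the sign
    appears because [G] is skew. *)
Let second_form_actG X Y z : tangent_field X -> tangent_field Y -> hz X -> hz Y ->
  normal z -> gdot g y (D X (act G Y) y) z = - gdot g y (D X Y y) (z *m G y).
Proof.
move=> tX tY hX hY nz; have [Z hZ Zy] := extend_normal nz.
have := nablaG hg hD N hX hY hZ By.
have -> : act G Z y = z *m G y by rewrite /act Zy.
rewrite Zy (nz _ ((tangent_actH tY).2 p Wp)) mulr0.
by move/eqP; rewrite addr_eq0 => /eqP.
Qed.

Let second_form_actH X Y z : tangent_field X -> tangent_field Y -> hz X -> hz Y ->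
  normal z -> gdot g y (D X (act H Y) y) z = - gdot g y (D X Y y) (z *m H y).
Proof.
move=> tX tY hX hY nz; have [Z hZ Zy] := extend_normal nz.
have := nablaG hg hD N' (hz_swap hX) (hz_swap hY) (hz_swap hZ) By.
have -> : act H Z y = z *m H y by rewrite /act Zy.
rewrite Zy (nz _ ((tangent_actG tY).2 p Wp)) mulr0.
by move/eqP; rewrite addr_eq0 => /eqP.
Qed.

(* The second fundamental form commutes with G and with H in each argument, so
   evaluating it on (G X, H Y) in two orders gives [h GH = h HG = - h GH]. *)
Let second_form_GH X Y z : tangent_field X -> tangent_field Y -> hz X -> hz Y ->
  normal z -> gdot g y (D X Y y) (z *m G y *m H y) = 0.
Proof.
move=> tX tY hX hY nz.
have tGX := tangent_actG tX; have tHY := tangent_actH tY.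
have hGX := horizontal_actG hg N tX.1; have hHY := horizontal_actH tY.1.
have nG := normal_actG nz; have nH := normal_actH nz.
have E1 := second_form_actH tGX tY hGX hY nz.
rewrite (second_form_sym tGX tY nH) (second_form_actG tY tX hY hX nH) opprK in E1.
rewrite (second_form_sym tY tX (normal_actG nH)) in E1.
have E2 := second_form_actG tHY tX hHY hX nz.
rewrite (second_form_sym tHY tX nG) (second_form_actH tX tY hX hY nG) opprK in E2.
have HG : z *m G y *m H y = - (z *m H y *m G y) := hn_HG N (fun=> z) By.
have E3 := second_form_sym tGX tHY nz.
rewrite E1 E2 in E3; move: E3; rewrite HG (gdotNr hg); lra.
Qed.

(** [second_form_GH] only tests against vectors [z *m G y *m H y]. On horizontal vectors this
    composite squares to - 1, so every normal vector has that form. *)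
Let second_form_horizontal X Y z : tangent_field X -> tangent_field Y ->
  hz X -> hz Y -> normal z -> gdot g y (D X Y y) z = 0.
Proof.
move=> tX tY hX hY nz; have nGH := normal_actH (normal_actG nz).
have := second_form_GH tX tY hX hY nGH.
have HG v : v *m G y *m H y = - (v *m H y *m G y) := hn_HG N (fun=> v) By.
have GG : z *m G y *m G y = - z.
  exact: (hn_GG N (X := fun=> z) By (normalU nz) (normalV nz)).
have HH : z *m H y *m H y = - z.
  exact: (hn_GG N' (X := fun=> z) By (normalV nz) (normalU nz)).
have -> : z *m G y *m H y *m G y *m H y = - z.
  rewrite -[z *m G y *m H y *m G y]opprK -HG GG.
  by rewrite !mulNmx opprK HH.
by rewrite (gdotNr hg) => /eqP; rewrite oppr_eq0 => /eqP.
Qed.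

Lemma second_form0 X Y z : tangent_field X -> tangent_field Y ->
  (forall v, (v <= dmap iota p)%MS -> gdot g (iota p) v z = 0) ->
  gdot g (iota p) (D X Y (iota p)) z = 0.
Proof.
move=> tX tY nz.
have thX := tangent_hor tX; have thY := tangent_hor tY.
rewrite -(second_form_hor tX tY nz) (second_form_sym thX tY nz).
rewrite -(second_form_hor tY thX nz).
exact: (second_form_horizontal thY thX (horizontal_hor hg N tY.1)
  (horizontal_hor hg N tX.1) nz).
Qed.

End QuaternionSubmanifold.

#[local] Transparent gdot.

(** * Double orthogonals and transversal components *)

Section NullDecomposition.
Context {R : realType} {k m : nat} (M : manifold R k) (Mb : manifold R m).
Variables (g : Mb -> 'M[R]_m) (iota : M -> Mb).
Hypothesis hg : semi_riemannian g.
Implicit Types (p : M) (v w z : 'rV[R]_m) (A E : 'M[R]_m).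

Lemma gdot_orth p E v w : (v <= orth g iota p E)%MS -> (w <= E)%MS ->
  gdot g (iota p) v w = 0.
Proof.
rewrite /orth => /sub_kermxP; rewrite mulmxA => v0 /submxP [c ->].
by rewrite /gdot trmx_mul mulmxA v0 mul0mx mxE.
Qed.

(** As the ambient metric is invertible, each covector annihilating [A] is the product with some [z]
    orthogonal to [A]; the columns of [cokermx A] supply enough of them. *)
Lemma submx_double_orth p a (A : 'M[R]_(a, m)) w :
  (forall z, (forall v, (v <= A)%MS -> gdot g (iota p) v z = 0) ->
     gdot g (iota p) w z = 0) ->
  (w <= A)%MS.
Proof.
move=> h; rewrite submxE; apply/eqP/rowP => j; rewrite [RHS]mxE.
pose z : 'rV[R]_m := (invmx (g (iota p)) *m col j (cokermx A))^T.
have zE v : gdot g (iota p) v z = (v *m cokermx A) 0 j.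
  rewrite /gdot trmxK mulmxA mulmxK; last exact: metric_nondeg hg _.
  by rewrite colE mulmxA -colE mxE.
rewrite -zE; apply: h => v /submxP [c ->].
by rewrite zE -mulmxA mulmx_coker mulmx0 mxE.
Qed.

Variables (r : nat) (Sc St L : M -> 'M[R]_m).
Hypotheses (hSt : screen_transversal g iota St) (hL : null_transversal g iota r Sc St L).

Let radical_orth p : (radical g iota p <= orth g iota p (tangent iota p))%MS.
Proof. exact: capmxSr. Qed.

Let screen_orth p : (St p <= orth g iota p (tangent iota p))%MS.
Proof. by have [_ _ _ <-] := hSt.2 p; exact: addsmxSr. Qed.

(* An element of L is determined by its products with a basis of the radical,
   to which the tangent and the screen transversal vectors are orthogonal. *)
Let null_eq0 p l v : (l <= L p)%MS -> (v <= tangent iota p + St p)%MS ->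
  (forall x, (x <= radical g iota p)%MS ->
     gdot g (iota p) x l = gdot g (iota p) x v) ->
  l = 0.
Proof.
move=> lL vTS lv.
have [W [xi [N [_ Wp [_ bxi] [_ bN] dual]]]] := hL p.
have [_ Exi] := bxi p Wp; have [_ EN] := bN p Wp.
have xi_rad i : (xi i p <= radical g iota p)%MS.
  by rewrite Exi; apply: eq_row_sub (i) _; rewrite rowK.
have rad_v x : (x <= radical g iota p)%MS -> gdot g (iota p) x v = 0.
  move=> xr; have /sub_addsmxP [[a b] ->] := vTS; rewrite (gdotDr hg) /=.
  rewrite (gdot_orth (submx_trans xr (radical_orth p)) (submxMl _ _)).
  rewrite (gdotC hg) (gdot_orth (submx_trans (submxMl _ _) (screen_orth p))) ?addr0 //.
  exact: submx_trans xr (capmxSl _ _).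
move: lL; rewrite EN => /submxP [a Ea].
have lE : l = \sum_i a 0 i *: N i p.
  rewrite Ea mulmx_sum_row; apply: eq_bigr => i _; by rewrite rowK.
suff a0 j : a 0 j = 0 by rewrite lE big1 // => i _; rewrite a0 scale0r.
have := lv _ (xi_rad j); rewrite rad_v // lE (gdotC hg).
rewrite (_ : gdot _ _ _ _ = \sum_i a 0 i * gdot g (iota p) (N i p) (xi j p)).
  rewrite (bigD1 j) //= big1 ?addr0 => [|i ij].
    by have [_ _ + _] := dual p Wp j j; rewrite (gdotC hg) eqxx => ->; rewrite mulr1.
  have [_ _ + _] := dual p Wp j i; rewrite (gdotC hg) eq_sym (negbTE ij) => ->.
  by rewrite mulr0.
elim/big_rec2: _ => [|i x y _ <-]; first by rewrite (gdot0l g).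
by rewrite (gdotDl g) (gdotZl g).
Qed.

Lemma ltr_part_tangent p w : (w <= tangent iota p)%MS -> ltr_part iota St L p w = 0.
Proof.
move=> wT; apply: proj_mx_0; last exact: submx_trans wT (addsmxSl _ _).
apply/eqP/rowV0P => v; rewrite sub_capmx => /andP [vL vTS].
exact: null_eq0 vL vTS (fun _ _ => erefl).
Qed.

(** [proj_mx] kills the second summand only if the two meet in 0. If v in [St] is t + l, then l = v
    - t lies in TM + [St] and so is 0; now v is tangent and normal, hence radical, and the radical
    meets [St] in 0. *)
Lemma str_part_tangent p w : (w <= tangent iota p)%MS -> str_part iota St L p w = 0.
Proof.
move=> wT; apply: proj_mx_0; last exact: submx_trans wT (addsmxSl _ _).
apply/eqP/rowV0P => v; rewrite sub_capmx => /andP [vS /sub_addsmxP [[a b] /= Ev]].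
pose l := b *m L p; pose t := a *m tangent iota p.
have l0 : l = 0.
  apply: (null_eq0 (p := p) (submxMl _ _) (v := v - t)).
    rewrite addmx_sub ?(submx_trans vS (addsmxSr _ _)) //.
    by rewrite eqmx_opp (submx_trans (submxMl _ _) (addsmxSl _ _)).
  by move=> x _; rewrite Ev addrC addKr.
have vT : (v <= tangent iota p)%MS by rewrite Ev -/l l0 addr0 submxMl.
have [_ RS _ _] := hSt.2 p.
apply/eqP; rewrite -submx0 -RS sub_capmx vS andbT /radical sub_capmx vT.
exact: submx_trans vS (screen_orth p).
Qed.

End NullDecomposition.

(** * Invariance of TM under G and H *)

Section TangentInvariance.
Context {R : realType} {n k : nat} (Mb : complex_manifold R n.*2.+1).
Variables (C : contact_structure Mb) (F : cindex C -> frame Mb).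
Variables (g : Mb -> 'M[R]_(n.*2.+1 + n.*2.+1)) (M : manifold R k) (iota : M -> Mb).
Variable Sc : M -> 'M[R]_(n.*2.+1 + n.*2.+1).
Hypotheses (hSc : screen g iota Sc) (hquat : quaternion_submanifold F g iota Sc).

Let tangentE p : (radical g iota p + Sc p :=: dmap iota p)%MS.
Proof.
have [_ _ _ E] := hSc.2 p.
exact: eqmx_trans E (genmxE _).
Qed.

Let stable_tangent p (A : 'M[R]_(n.*2.+1 + n.*2.+1)) :
  stablemx (radical g iota p) A -> stablemx (Sc p) A -> stablemx (dmap iota p) A.
Proof.
move=> sR sS; rewrite -(eqmxMr A (tangentE p)) -(tangentE p).
by rewrite addsmxMr addsmxS.
Qed.

Lemma quaternion_tangent i p : cset i (iota p) ->
  [/\ (fU (F i) (iota p) <= dmap iota p)%MS, (fV (F i) (iota p) <= dmap iota p)%MS,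
      stablemx (dmap iota p) (fG (F i) (iota p)) &
      stablemx (dmap iota p) (fH (F i) (iota p))].
Proof.
move=> ip; have [US VS [_ RG RH] [_ SG SH]] := hquat ip.
have ST : (Sc p <= dmap iota p)%MS by rewrite -(tangentE p) addsmxSr.
by split; [exact: submx_trans US ST|exact: submx_trans VS ST
  |exact: stable_tangent|exact: stable_tangent].
Qed.

End TangentInvariance.

Theorem corollary3p4 (R : realType) (n q k r : nat)
  (Mb : complex_manifold R n.*2.+1)
  (g : Mb -> 'M[R]_(n.*2.+1 + n.*2.+1))
  (D : vfield Mb -> vfield Mb -> vfield Mb)
  (C : contact_structure Mb) (F : cindex C -> frame Mb)
  (M : manifold R k) (iota : M -> Mb)
  (Sc St L : M -> 'M[R]_(n.*2.+1 + n.*2.+1))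
  (hq : (0 < q < n)%N)
  (hg : semi_riemannian g) (hherm : hermitian_metric g)
  (hindex : forall p, has_index (g p) (4 * q))
  (hD : levi_civita g D)
  (hF : contact_metric_structure g D F)
  (hnormal : normal_structure g D F)
  (hM : immersed_submanifold iota)
  (hnull : null_submanifold g iota r)
  (hSc : screen g iota Sc) (hSt : screen_transversal g iota St)
  (hL : null_transversal g iota r Sc St L)
  (hquat : quaternion_submanifold F g iota Sc) :
  totally_geodesic iota D St L.
Proof.
move=> O1 X Y p w _ _ _ _ [W [A [Xb [Yb [[oW Wp] oA [sXb sYb] ext ->]]]]].
have [smooth_iota _ free] := hM.
have [i ip] := cset_cover C (iota p).
(* [cset i] provides a single frame, and the chart domain makes room for the coordinate fields that
   extend normal vectors. *)
pose B := A `&` (cset i `&` dom Mb (iota p)).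
have oB : open B.
  by apply: openI => //; apply: openI; [exact: cset_open|exact: dom_open].
have subA : B `<=` A by move=> x [].
have subC : B `<=` cset i by move=> x [_ []].
have subD : B `<=` dom Mb (iota p) by move=> x [_ []].
pose W' := W `&` iota @^-1` B.
have oW' : open W' by apply: openI => //; exact: open_preimage.
have W'p : W' p.
  by split=> //; split; [have [] := ext p Wp|split=> //; exact: dom_self].
have cf := hF.1 i; have nB := hnormal i B oB subC.
have N := half_normal_frame hg hherm hD cf oB subC nB.
have N' := half_normal_frame' hg hherm hD cf oB subC nB.
have WB q' : W' q' -> B (iota q') by case.
have T q' : W' q' -> _ := fun h => quaternion_tangent hSc hquat (subC _ (WB _ h)).
have tU q' : W' q' -> (fU (F i) (iota q') <= dmap iota q')%MS by move=> /T [].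
have tV q' : W' q' -> (fV (F i) (iota q') <= dmap iota q')%MS by move=> /T [].
have tG q' : W' q' -> stablemx (dmap iota q') (fG (F i) (iota q')) by move=> /T [].
have tH q' : W' q' -> stablemx (dmap iota q') (fH (F i) (iota q')) by move=> /T [].
have tX : tangent_field iota B W' Xb.
  split; first exact: smooth_vf_sub subA sXb.
  by move=> q' [Wq' _]; have [_ -> _] := ext q' Wq'; exact: submxMl.
have tY : tangent_field iota B W' Yb.
  split; first exact: smooth_vf_sub subA sYb.
  by move=> q' [Wq' _]; have [_ _ ->] := ext q' Wq'; exact: submxMl.
(* Both transversal components vanish on tangent vectors, so tangency of the ambient derivative
   suffices; it is tested against all normal vectors. *)
have wT : (D Xb Yb (iota p) <= tangent iota p)%MS.
  rewrite /tangent genmxE; apply: (submx_double_orth hg) => z nz.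
  exact: (second_form0 hg hD smooth_iota oW' W'p subD N N' (free p) WB tU tV tG tH
    tX tY nz).
split; first exact: (ltr_part_tangent hg hSt hL wT).
exact: (str_part_tangent hg hSt hL wT).
Qed.
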